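(* Let $n\geq 3$ and let $A,B\in\mathbb{R}^{n\times n}$ with $\|A\|_{\mathrm{tr}}=\|B\|_{\mathrm{tr}}=1$. Let $X^*$ be the optimal solution to $$\max_{X\in\mathrm{SO}(n)}\{\langle A,X\rangle:\ \langle B,X\rangle\in[a,b]\}.$$ Then one can compute $\langle A,X^*\rangle$ and $\langle B,X^*\rangle$ within an additive error of $\epsilon$ in time $$O\left(n^3\log\left(\tfrac1\epsilon\right)^2\right),$$ where $n^3$ is the time complexity of computing the SVD of an $n\times n$ matrix. Moreover, the algorithm returns $\alpha,\beta\in\mathbb{R}$ such that $|\alpha|+|\beta|=1$ and $$\langle\alpha A+\beta B,X^*\rangle+\epsilon\ \geq\ \max\{\langle\alpha A+\beta B,X\rangle:\ X\in\mathrm{SO}(n)\}.$$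
   Context: $\mathrm{SO}(n)=\{X\in\mathbb{R}^{n\times n}: X^\intercal X=I,\ \det(X)=1\}$; $\langle A,X\rangle=\operatorname{tr}(A^\intercal X)$; $\|A\|_{\mathrm{tr}}$ is the trace norm, the sum of the singular values of $A$. Here $a\le b$ are real numbers defining the (two-sided) constraint. Running time counts basic arithmetic operations on real numbers, including square roots, which are assumed to be performed exactly, and an SVD of an $n\times n$ matrix is assumed to cost $O(n^3)$. *)

(* Defs.v *)
From HB Require Import structures.
From mathcomp Require Import all_boot all_order all_algebra.
From mathcomp Require Import all_classical all_reals all_analysis.

Set Implicit Arguments.
Unset Strict Implicit.
Unset Printing Implicit Defensive.

Import Order.TTheory GRing.Theory Num.Theory.
Local Open Scope classical_set_scope.
Local Open Scope ring_scope.

Definition SO (R : realType) (n : nat) : set 'M[R]_n :=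
  [set X | X^T *m X = 1%:M /\ \det X = 1].

Definition mxip (R : realType) (n : nat) (A X : 'M[R]_n) : R := \tr (A^T *m X).

Definition is_svd (R : realType) (n : nat) (A U : 'M[R]_n) (s : 'rV[R]_n)
    (V : 'M[R]_n) : Prop :=
  [/\ U^T *m U = 1%:M, V^T *m V = 1%:M,
      forall i, 0 <= s 0 i,
      forall i j : 'I_n, (i <= j)%N -> s 0 j <= s 0 i
    & A = U *m diag_mx s *m V^T].

(* The nonincreasing sequence of singular values exists and is unique, so the
   choice operator has exactly one candidate and its default 0 is not used. *)
Definition singular_values (R : realType) (n : nat) (A : 'M[R]_n) : 'rV[R]_n :=
  xget 0 [set s | exists U V, is_svd A U s V].

Definition trace_norm (R : realType) (n : nat) (A : 'M[R]_n) : R :=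
  \sum_i singular_values A 0 i.

Definition feasible (R : realType) (n : nat) (B : 'M[R]_n) (a b : R) :
    set 'M[R]_n :=
  [set X | SO X /\ a <= mxip B X <= b].

Definition optimal (R : realType) (n : nat) (A B : 'M[R]_n) (a b : R) :
    set 'M[R]_n :=
  [set X | feasible B a b X /\
           forall Y, feasible B a b Y -> mxip A Y <= mxip A X].

(* Real RAM.  A program is a finite piece of syntax that contains no real
   constant and does not depend on the input (in particular not on the
   dimension).  The memory consists of registers holding natural numbers, used
   for counting and indexing, and of two-dimensional arrays of reals.  Registers
   and arrays are named by natural numbers.  There is no rounding operation: the
   content of the registers can be copied to the real memory, but not
   conversely. *)
Inductive nexp : Type :=
| NConst of nat
| NReg of nat
| NAdd of nexp & nexp
| NSub of nexp & nexp.

Inductive rexp : Type :=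
| RNat of nexp
| RGet of nat & nexp & nexp
| RAdd of rexp & rexp
| RSub of rexp & rexp
| RMul of rexp & rexp
| RDiv of rexp & rexp
| RSqrt of rexp.

Inductive bexp : Type :=
| BNLe of nexp & nexp
| BRLe of rexp & rexp
| BNot of bexp.

(* [CSvd m x u s v] decomposes the leading m x m block of array x, writing the
   orthogonal factors to arrays u and v and the singular values to row 0 of
   array s. *)
Inductive cmd : Type :=
| CSkip
| CNSet of nat & nexp
| CRSet of nat & nexp & nexp & rexp
| CSeq of cmd & cmd
| CIf of bexp & cmd & cmd
| CWhile of bexp & cmd
| CSvd of nexp & nat & nat & nat & nat.

Record state (R : realType) : Type := State {
  regs : nat -> nat;
  arrays : nat -> nat -> nat -> R }.

Section Semantics.
Variable R : realType.
Implicit Types st : state R.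

Fixpoint nval st (e : nexp) : nat :=
  match e with
  | NConst k => k
  | NReg x => regs st x
  | NAdd e f => (nval st e + nval st f)%N
  | NSub e f => (nval st e - nval st f)%N
  end.

(* Division by 0 returns 0, and so does the square root of a negative number;
   programs can test for both. *)
Fixpoint rval st (e : rexp) : R :=
  match e with
  | RNat k => (nval st k)%:R
  | RGet x i j => arrays st x (nval st i) (nval st j)
  | RAdd e f => rval st e + rval st f
  | RSub e f => rval st e - rval st f
  | RMul e f => rval st e * rval st f
  | RDiv e f => rval st e / rval st f
  | RSqrt e => Num.sqrt (rval st e)
  end.

Fixpoint bval st (e : bexp) : bool :=
  match e with
  | BNLe e f => (nval st e <= nval st f)%N
  | BRLe e f => rval st e <= rval st f
  | BNot e => ~~ bval st e
  end.

Definition set_reg st (x k : nat) : state R :=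
  State (fun y => if y == x then k else regs st y) (arrays st).

Definition set_cell st (x i j : nat) (r : R) : state R :=
  State (regs st) (fun y k l =>
    if [&& y == x, k == i & l == j] then r else arrays st y k l).

Definition get_mx st (m p x : nat) : 'M[R]_(m, p) :=
  \matrix_(i, j) arrays st x i j.

Definition put_mx st (m p x : nat) (M : 'M[R]_(m, p)) : state R :=
  State (regs st) (fun y k l =>
    if y == x then
      match insub k, insub l with
      | Some i, Some j => M i j
      | _, _ => arrays st y k l
      end
    else arrays st y k l).

Definition svd_routine : Type :=
  forall m : nat, 'M[R]_m -> 'M[R]_m * 'rV[R]_m * 'M[R]_m.

Definition svd_correct (svd : svd_routine) : Prop :=
  forall (m : nat) (M : 'M[R]_m),
    let: (U, s, V) := svd m M in is_svd M U s V.

Definition do_svd (svd : svd_routine) st (m x u s v : nat) : state R :=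
  let: (U, d, V) := svd m (get_mx st m m x) in
  put_mx (put_mx (put_mx st u U) s d) v V.

End Semantics.

Fixpoint ncost (e : nexp) : nat :=
  match e with
  | NConst _ | NReg _ => 1
  | NAdd e f | NSub e f => (ncost e + ncost f).+1
  end.

Fixpoint rcost (e : rexp) : nat :=
  match e with
  | RNat k => (ncost k).+1
  | RGet _ i j => (ncost i + ncost j).+1
  | RAdd e f | RSub e f | RMul e f | RDiv e f => (rcost e + rcost f).+1
  | RSqrt e => (rcost e).+1
  end.

Fixpoint bcost (e : bexp) : nat :=
  match e with
  | BNLe e f => (ncost e + ncost f).+1
  | BRLe e f => (rcost e + rcost f).+1
  | BNot e => (bcost e).+1
  end.

(* [exec svd c st t st']: started in st, the program c halts in st' after t
   elementary steps, an SVD of an m x m matrix counting for m ^ 3 steps. *)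
Inductive exec (R : realType) (svd : svd_routine R) :
    cmd -> state R -> nat -> state R -> Prop :=
| ExecSkip st : exec svd CSkip st 1 st
| ExecNSet st x e :
    exec svd (CNSet x e) st (ncost e).+1 (set_reg st x (nval st e))
| ExecRSet st x i j e :
    exec svd (CRSet x i j e) st (ncost i + ncost j + rcost e).+1
      (set_cell st x (nval st i) (nval st j) (rval st e))
| ExecSeq c d st t st' t' st'' :
    exec svd c st t st' -> exec svd d st' t' st'' ->
    exec svd (CSeq c d) st (t + t') st''
| ExecIf b c d st t st' :
    exec svd (if bval st b then c else d) st t st' ->
    exec svd (CIf b c d) st (bcost b + t).+1 st'
| ExecWhileStop b c st :
    ~~ bval st b -> exec svd (CWhile b c) st (bcost b).+1 st
| ExecWhileStep b c st t st' t' st'' :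
    bval st b -> exec svd c st t st' -> exec svd (CWhile b c) st' t' st'' ->
    exec svd (CWhile b c) st (bcost b + t + t').+1 st''
| ExecSvd m x u s v st :
    exec svd (CSvd m x u s v) st (ncost m + nval st m ^ 3).+1
      (do_svd svd st (nval st m) x u s v).

(* A program has at most one run from a given state, so that the existence of a
   run with some property says that the program halts with that property. *)
Lemma exec_det (R : realType) (svd : svd_routine R) c st t1 st1 t2 st2 :
  exec svd c st t1 st1 -> exec svd c st t2 st2 -> t1 = t2 /\ st1 = st2.
Proof.
move=> h; elim: h t2 st2 => {c st t1 st1}.
- by move=> st t2 st2 h; inversion h.
- by move=> st x e t2 st2 h; inversion h.
- by move=> st x i j e t2 st2 h; inversion h.
- move=> c d st t st' t' st'' _ IHc _ IHd t2 st2 h.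
  inversion h as [| | |? ? ? u su u' su' hc hd| | | |]; subst.
  by have [? ?] := IHc _ _ hc; subst; have [? ?] := IHd _ _ hd; subst.
- move=> b c d st t st' _ IH t2 st2 h.
  inversion h as [| | | |? ? ? ? u su hc| | |]; subst.
  by have [? ?] := IH _ _ hc; subst.
- move=> b c st nb t2 st2 h; inversion h as [| | | | | |? ? ? ? ? ? ? yb|] => //.
  by rewrite yb in nb.
- move=> b c st t st' t' st'' yb _ IHc _ IHw t2 st2 h.
  inversion h as [| | | | |? ? ? nb|? ? ? u su u' su' _ hc hw|]; subst.
    by rewrite yb in nb.
  by have [? ?] := IHc _ _ hc; subst; have [? ?] := IHw _ _ hw; subst.
- by move=> m x u s v st t2 st2 h; inversion h.
Qed.

(* Input: n in register 0, A in array 0, B in array 1, and a, b, eps in row 0 of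
   array 2; all other cells contain 0. *)
Definition input (R : realType) (n : nat) (A B : 'M[R]_n) (a b eps : R) :
    state R :=
  let blank := State (fun=> 0%N) (fun _ _ _ => 0) in
  let st := put_mx (put_mx (set_reg blank 0 n) 0 A) 1 B in
  set_cell (set_cell (set_cell st 2 0 0 a) 2 0 1 b) 2 0 2 eps.

(* The k-th number returned is read in row 0 of array 3. *)
Definition output (R : realType) (st : state R) (k : nat) : R := arrays st 3 0 k.

(* Main.v *)
Require Import Defs.
From HB Require Import structures.
From mathcomp Require Import all_boot all_order all_algebra.
From mathcomp Require Import all_classical all_reals all_analysis.
From mathcomp Require Import ring lra zify.

Set Implicit Arguments.
Unset Strict Implicit.
Unset Printing Implicit Defensive.

Import Order.TTheory GRing.Theory Num.Theory.
Local Open Scope classical_set_scope.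
Local Open Scope ring_scope.

(* Write [x = <A, X>], [y = <B, X>] and suppose that a maximizer of [x] over SO(n)
   violates [y <= b] (the case [a <= y] is symmetric).  Every set of maximizers of
   a linear functional over SO(n) has an interval as image under [y]: its elements
   are joined by arcs of products of reflections, on which [y] is a ratio of
   quadratic forms.  Hence, if [b] is above [ymin = min y], some [lam >= 0] has a
   maximizer of [x - lam y] with [y = b], which is optimal for the constrained
   problem.  Since [|x| <= 1] one may take [lam <= 2 / (b - ymin)], and the dual
   function [max (x - lam y) + lam b] has slope at most [b - ymin] to the right of
   any point.  So after rescaling [lam] by [b - ymin], bisection on an interval of
   length 2 up to precision [eps] suffices, whatever the conditioning of the
   problem: this takes O(log (1 / eps)) SVDs.
   If [b = ymin], the constrained problem lives on a face of SO(n) which an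
   explicit spectral gap of [B] separates from the rest quadratically, and a
   multiplier computed from this gap and [eps] does the job.
   A maximizer of [<C, X>] over SO(n) is [U diag(1, ..., 1, d) V^T] for an SVD
   [C = U S V^T] and [d = det U det V]. *)

(** * Orthogonal matrices and reflections *)

(** A maximizer found at an approximate multiplier can be a poor primal point: faces can be large,
    and [y] can jump across the level [b] under an arbitrarily small change of [lam]. So when the
    constraint is active no near-optimal [X] is built. The first number returned is the dual value
    at the multiplier, an upper bound of the optimum; the second is the violated bound itself, which
    some optimal [X] attains exactly. The direction [(1, -lam)] is normalized by [1 + lam >= 1],
    which only shrinks the dual error, so a huge [lam] is harmless. This matters when [b = ymin].
    There [x] may exceed its maximum on the face by an amount linear in the distance to the face,
    while [y - b] grows at least quadratically in it. The AM-GM inequality trades the linear excess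
    for [eps] plus a multiple of order [1 / eps] of [y - b], and that multiple is the multiplier. No
    loop depends on its size, so it does not affect the running time. *)

Section Reflections.
Variables (R : realType) (n : nat).
Implicit Types (u v w x y z : 'cV[R]_n) (Q X Y A S : 'M[R]_n).

Definition orth Q : Prop := Q^T *m Q = 1%:M.

Definition dot u v : R := (u^T *m v) 0 0.

(* [refl 0] is the identity, since [2 / 0 = 0]. *)
Definition refl v : 'M[R]_n := 1%:M - (2 / dot v v) *: (v *m v^T).

Lemma orth_tr Q : orth Q -> orth Q^T.
Proof. by move=> h; rewrite /orth trmxK; apply: mulmx1C. Qed.

Lemma orthM Q X : orth Q -> orth X -> orth (Q *m X).
Proof.
by move=> hQ hX; rewrite /orth trmx_mul mulmxA -(mulmxA _ _ Q) hQ mulmx1.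
Qed.

Lemma orth_det Q : orth Q -> \det Q = 1 \/ \det Q = -1.
Proof.
move=> /(congr1 determinant); rewrite det_mulmx det_tr det1 -expr2 => /eqP.
by rewrite sqrf_eq1 => /orP[]/eqP; [left|right].
Qed.

Lemma orth_det_sqr Q : orth Q -> \det Q * \det Q = 1.
Proof. by case/orth_det => ->; rewrite ?mulr1 // mulrNN mulr1. Qed.

Lemma dotE u v : dot u v = \sum_i u i 0 * v i 0.
Proof. by rewrite /dot mxE; apply: eq_bigr => i _; rewrite mxE. Qed.

Lemma dotC u v : dot u v = dot v u.
Proof. by rewrite !dotE; apply: eq_bigr => i _; rewrite mulrC. Qed.

Lemma dotDl u v w : dot (u + v) w = dot u w + dot v w.
Proof. by rewrite /dot linearD mulmxDl mxE. Qed.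

Lemma dotDr u v w : dot w (u + v) = dot w u + dot w v.
Proof. by rewrite dotC dotDl !(dotC w). Qed.

Lemma dotZl a u v : dot (a *: u) v = a * dot u v.
Proof. by rewrite /dot linearZ -scalemxAl mxE. Qed.

Lemma dotZr a u v : dot u (a *: v) = a * dot u v.
Proof. by rewrite dotC dotZl dotC. Qed.

Lemma dotNl u v : dot (- u) v = - dot u v.
Proof. by rewrite -scaleN1r dotZl mulN1r. Qed.

Lemma dotNr u v : dot u (- v) = - dot u v.
Proof. by rewrite dotC dotNl dotC. Qed.

Lemma dotBl u v w : dot (u - v) w = dot u w - dot v w.
Proof. by rewrite dotDl dotNl. Qed.

Lemma dotBr u v w : dot w (u - v) = dot w u - dot w v.
Proof. by rewrite dotDr dotNr. Qed.

Lemma dot_ge0 v : 0 <= dot v v.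
Proof. by rewrite dotE sumr_ge0 // => i _; rewrite -expr2 sqr_ge0. Qed.

Lemma dot_eq0 v : (dot v v == 0) = (v == 0).
Proof.
apply/eqP/eqP => [|->]; last first.
  by rewrite dotE big1 // => i _; rewrite mxE mul0r.
rewrite dotE => h; apply/matrixP => i j; rewrite ord1 mxE.
have := @psumr_eq0P _ _ xpredT (fun i => v i 0 * v i 0) _ h i isT.
move=> /(_ (fun i _ => _))/eqP; rewrite -expr2 sqrf_eq0 => e.
by apply/eqP/e => k; rewrite -expr2 sqr_ge0.
Qed.

Lemma dot_gt0 v : v != 0 -> 0 < dot v v.
Proof. by move=> v0; rewrite lt_def dot_ge0 dot_eq0 v0. Qed.

Lemma dot_orth Q u v : orth Q -> dot (Q *m u) (Q *m v) = dot u v.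
Proof. by move=> hQ; rewrite /dot trmx_mul -mulmxA (mulmxA Q^T) hQ mul1mx. Qed.

Lemma dot_adj Q u v : dot (Q *m u) v = dot u (Q^T *m v).
Proof. by rewrite /dot trmx_mul mulmxA. Qed.

Lemma outer_mul v w : (v *m v^T) *m w = dot v w *: v.
Proof.
by rewrite -mulmxA (mx11_scalar (v^T *m w)) mul_mx_scalar.
Qed.

Lemma refl_mul v w : refl v *m w = w - (2 * dot v w / dot v v) *: v.
Proof.
rewrite mulmxBl mul1mx -scalemxAl outer_mul scalerA; congr (_ - _ *: _).
by rewrite mulrAC.
Qed.

Lemma refl_tr v : (refl v)^T = refl v.
Proof. by rewrite linearB linearZ /= trmx1 trmx_mul trmxK. Qed.

Lemma mx_ext m (X Y : 'M[R]_(m, n)) : (forall v, X *m v = Y *m v) -> X = Y.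
Proof.
move=> h; apply/matrixP => i j.
by have := h (delta_mx j 0); rewrite -!colE => /colP/(_ i); rewrite !mxE.
Qed.

Lemma reflK v : refl v *m refl v = 1%:M.
Proof.
apply: mx_ext => w; rewrite -mulmxA mul1mx !refl_mul.
have [->|v0] := eqVneq v 0; first by rewrite !scaler0 !subr0.
rewrite -addrA -opprD -scalerDl dotBr dotZr.
have d0 : dot v v != 0 by rewrite dot_eq0.
have -> : 2 * dot v w / dot v v +
    2 * (dot v w - 2 * dot v w / dot v v * dot v v) / dot v v = 0 by field.
by rewrite scale0r subr0.
Qed.

Lemma refl_orth v : orth (refl v).
Proof. by rewrite /orth refl_tr reflK. Qed.

Lemma refl_fix v w : dot v w = 0 -> refl v *m w = w.
Proof. by move=> h; rewrite refl_mul h mulr0 mul0r scale0r subr0. Qed.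

Lemma reflv v : v != 0 -> refl v *m v = - v.
Proof.
rewrite -dot_eq0 => v0; rewrite refl_mul mulfK //.
by rewrite scaler_nat mulr2n opprD addNKr.
Qed.

Lemma refl_swap x y : dot x x = dot y y -> refl (x - y) *m x = y.
Proof.
move=> e; have [/eqP xy|xy] := eqVneq (x - y) 0.
  by rewrite subr_eq0 in xy; rewrite (eqP xy) subrr refl_fix // dotE big1 // => i _;
     rewrite mxE mul0r.
rewrite refl_mul (_ : _ / _ = 1) ?scale1r ?subKr //.
have : dot (x - y) (x - y) != 0 by rewrite dot_eq0.
have -> : dot (x - y) (x - y) = 2 * dot (x - y) x.
  by rewrite !dotBl !dotBr (dotC y x) -e; ring.
by move=> h; rewrite divff.
Qed.

(** The bordered matrix with blocks [1, v, w^T, 1] is eliminated in two ways, once from each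
    diagonal block; the two Schur complements have the same determinant. *)
Lemma det_sub_outer v w : \det (1%:M - v *m w^T) = 1 - dot w v.
Proof.
have e1 : block_mx 1%:M 0 w^T 1%:M *m block_mx 1%:M v 0 (1 - dot w v)%:M =
    block_mx (1%:M : 'M[R]_n) v w^T (1%:M : 'M[R]_1).
  rewrite mulmx_block !mul1mx !mul0mx !mulmx1 ?mulmx0 ?addr0.
  by rewrite (mx11_scalar (w^T *m v)) -/(dot w v) -raddfD /= addrC subrK.
have e2 : block_mx (1%:M - v *m w^T) v 0 1%:M *m block_mx 1%:M 0 w^T 1%:M =
    block_mx (1%:M : 'M[R]_n) v w^T (1%:M : 'M[R]_1).
  by rewrite mulmx_block !mul1mx !mul0mx !mulmx1 !mulmx0 !add0r subrK.
have := congr1 determinant e1; rewrite -e2 !det_mulmx !det_lblock !det_ublock.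
by rewrite !det1 !det_scalar1 !mul1r !mulr1 => ->.
Qed.

Lemma det_refl v : v != 0 -> \det (refl v) = -1.
Proof.
rewrite -dot_eq0 => v0; rewrite /refl.
have -> : (2 / dot v v) *: (v *m v^T) = v *m ((2 / dot v v) *: v)^T.
  by rewrite linearZ /= scalemxAr.
by rewrite det_sub_outer dotZl divfK //; ring.
Qed.

(** The identity [(1 + Q)^T = Q^T (1 + Q)] gives [det (1 + Q) = det Q * det (1 + Q)], so [1 + Q] is
    singular when [det Q = -1]. Read the other way, it gives [orth_det1]. *)
Lemma orth_opp_fix Q : orth Q -> \det Q = -1 ->
  exists2 v : 'cV[R]_n, v != 0 & Q *m v = - v.
Proof.
move=> hQ dQ.
have : \det (1%:M + Q)^T = 0.
  have e : (1%:M + Q)^T = Q^T *m (1%:M + Q).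
    by rewrite mulmxDr mulmx1 hQ linearD /= trmx1 addrC.
  apply/eqP; have := congr1 determinant e.
  rewrite det_mulmx det_tr [\det Q^T]det_tr dQ mulN1r => /eqP.
  by rewrite -subr_eq0 opprK -mulr2n -mulr_natr mulf_eq0 pnatr_eq0 orbF.
move=> /eqP/det0P[v v0 h]; exists v^T; first by rewrite trmx_eq0.
have := congr1 trmx h; rewrite trmx_mul trmxK trmx0 mulmxDl mul1mx => /eqP.
by rewrite addrC addr_eq0 => /eqP.
Qed.

Lemma orth_det1 Q : orth Q -> 1%:M + Q \in unitmx -> \det Q = 1.
Proof.
move=> hQ; rewrite unitmxE unitfE => h.
have e : (1%:M + Q)^T = Q^T *m (1%:M + Q).
  by rewrite mulmxDr mulmx1 hQ linearD /= trmx1 addrC.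
have := congr1 determinant e.
rewrite det_mulmx det_tr [\det Q^T]det_tr => {}e.
by apply: (mulIf h); rewrite mul1r -e.
Qed.

Lemma orth_entry_le1 Q i j : orth Q -> `|Q i j| <= 1.
Proof.
move=> hQ; rewrite -(@ler_pXn2r _ 2) ?nnegrE // expr1n -normrX ger0_norm ?sqr_ge0 //.
have -> : 1 = \sum_k Q k j ^+ 2.
  have e : \sum_k Q^T j k * Q k j = 1.
    by have /matrixP/(_ j j) := hQ; rewrite !mxE eqxx.
  by rewrite -[LHS]e; apply: eq_bigr => k _; rewrite mxE expr2.
by rewrite (bigD1 i) //= lerDl sumr_ge0 // => k _; rewrite sqr_ge0.
Qed.

Lemma orth_diag_le1 Q i : orth Q -> Q i i <= 1.
Proof. by move=> /orth_entry_le1-/(_ i i) => h; exact: le_trans (ler_norm _) h. Qed.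

(** Equality case of [orth_diag_le1]: the squared distance from [Q e_i] to [e_i] is
    [2 - 2 * Q i i]. *)
Lemma orth_col_fix Q i : orth Q -> Q i i = 1 ->
  Q *m delta_mx i 0 = delta_mx i 0 :> 'cV_n.
Proof.
move=> hQ q1; set e := delta_mx i 0; apply/eqP; rewrite -subr_eq0 -dot_eq0.
have ee : dot e e = 1.
  rewrite dotE (bigD1 i) //= mxE !eqxx mulr1 big1 ?addr0 // => k /negPf ki.
  by rewrite mxE ki mul0r.
have eq : dot e (Q *m e) = 1.
  rewrite -q1 dotE (bigD1 i) //= -colE !mxE !eqxx mul1r big1 ?addr0 // => k /negPf ki.
  by rewrite mxE ki mul0r.
by rewrite dotBl !dotBr dot_orth // (dotC (Q *m e)) eq ee; apply/eqP; ring.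
Qed.

End Reflections.

(** * Linear functionals on SO(n) and their faces *)

Section InnerProduct.
Variables (R : realType) (n : nat).
Implicit Types (A B C D P Q X Y : 'M[R]_n) (u v : 'cV[R]_n) (s : 'rV[R]_n).

Lemma mxipE A X : mxip A X = \sum_i \sum_j A i j * X i j.
Proof.
rewrite /mxip /mxtrace exchange_big; apply: eq_bigr => i _.
by rewrite mxE; apply: eq_bigr => j _; rewrite mxE.
Qed.

Lemma mxipC A X : mxip A X = mxip X A.
Proof.
by rewrite !mxipE; apply: eq_bigr => i _; apply: eq_bigr => j _; rewrite mulrC.
Qed.

Lemma mxipDr A X Y : mxip A (X + Y) = mxip A X + mxip A Y.
Proof. by rewrite /mxip mulmxDr mxtraceD. Qed.

Lemma mxipZr a A X : mxip A (a *: X) = a * mxip A X.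
Proof. by rewrite /mxip -scalemxAr mxtraceZ. Qed.

Lemma mxipNr A X : mxip A (- X) = - mxip A X.
Proof. by rewrite -scaleN1r mxipZr mulN1r. Qed.

Lemma mxipBr A X Y : mxip A (X - Y) = mxip A X - mxip A Y.
Proof. by rewrite mxipDr mxipNr. Qed.

Lemma mxipDl A X Y : mxip (X + Y) A = mxip X A + mxip Y A.
Proof. by rewrite !(mxipC _ A) mxipDr. Qed.

Lemma mxipZl a A X : mxip (a *: X) A = a * mxip X A.
Proof. by rewrite !(mxipC _ A) mxipZr. Qed.

Lemma mxipNl A X : mxip (- X) A = - mxip X A.
Proof. by rewrite !(mxipC _ A) mxipNr. Qed.

Lemma mxipBl A X Y : mxip (X - Y) A = mxip X A - mxip Y A.
Proof. by rewrite !(mxipC _ A) mxipBr. Qed.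

Lemma mxip_mull A P X : mxip A (P *m X) = mxip (P^T *m A) X.
Proof. by rewrite /mxip trmx_mul trmxK mulmxA. Qed.

Lemma mxip_mulr A P X : mxip A (X *m P) = mxip (A *m P^T) X.
Proof. by rewrite /mxip mulmxA mxtrace_mulC trmx_mul trmxK mulmxA. Qed.

Lemma mxip_orthl P A X : orth P -> mxip (P *m A) (P *m X) = mxip A X.
Proof. by move=> hP; rewrite mxip_mull mulmxA hP mul1mx. Qed.

Lemma mxip_orthr P A X : orth P -> mxip (A *m P) (X *m P) = mxip A X.
Proof.
by move=> /orth_tr; rewrite /orth trmxK => hP; rewrite mxip_mulr -mulmxA hP mulmx1.
Qed.

Lemma mxip_diag s X : mxip (diag_mx s) X = \sum_i s 0 i * X i i.
Proof.
rewrite mxipE; apply: eq_bigr => i _; rewrite (bigD1 i) //= big1 ?addr0.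
  by rewrite mxE eqxx.
by move=> j /negPf ji; rewrite mxE eq_sym ji mulr0n mul0r.
Qed.

Lemma mxip1 X : mxip 1%:M X = \tr X.
Proof. by rewrite /mxip trmx1 mul1mx. Qed.

Lemma mxip_outer A u v : mxip A (u *m v^T) = dot u (A *m v).
Proof.
rewrite /mxip mulmxA mxtrace_mulC (mx11_scalar (_ *m _)) mxtrace_scalar mulr1n.
by rewrite -[LHS]/(dot v (A^T *m u)) dotC dot_adj trmxK.
Qed.

Lemma mxip_refl A v : mxip A (refl v) = \tr A - 2 * dot v (A *m v) / dot v v.
Proof.
rewrite mxipBr mxipC mxip1 mxipZr mxip_outer.
by rewrite mulrAC.
Qed.

Lemma mxip_ge0 A : 0 <= mxip A A.
Proof.
by rewrite mxipE !sumr_ge0 // => i _; rewrite sumr_ge0 // => j _; rewrite -expr2 sqr_ge0.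
Qed.

(** Expand [mxip_ge0] at [2 e A - D]. A linear change becomes a free error [e] plus a squared
    distance over [4 e]; this is where the factor [1 / eps] in [face_gap] comes from. *)
Lemma mxip_am_gm e A D : 0 < e -> mxip A D <= e * mxip A A + mxip D D / (4 * e).
Proof.
move=> e0; have := mxip_ge0 ((2 * e) *: A - D).
rewrite !mxipBl !mxipBr !mxipZl !mxipZr (mxipC D A) => h.
rewrite -subr_ge0.
suff -> : e * mxip A A + mxip D D / (4 * e) - mxip A D =
   (2 * e * (2 * e * mxip A A) - 2 * e * mxip A D -
         (2 * e * mxip A D - mxip D D)) / (4 * e).
  by rewrite divr_ge0 // mulr_ge0 // ltW.
by field; apply: lt0r_neq0.
Qed.

Lemma mxip_orth Q : orth Q -> mxip Q Q = n%:R.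
Proof. by move=> hQ; rewrite /mxip hQ mxtrace1. Qed.

Lemma mxip_orth_sub X Y : orth X -> orth Y ->
  mxip (X - Y) (X - Y) = 2 * n%:R - 2 * mxip X Y.
Proof.
by move=> hX hY; rewrite mxipBl !mxipBr !mxip_orth // (mxipC Y); ring.
Qed.

Lemma diag_orth_le s W : (forall i, 0 <= s 0 i) -> orth W ->
  mxip (diag_mx s) W <= \sum_i s 0 i.
Proof.
move=> s0 hW; rewrite mxip_diag ler_sum // => i _.
by rewrite ler_piMr // orth_diag_le1.
Qed.

Lemma diag_orth_abs_le s W : (forall i, 0 <= s 0 i) -> orth W ->
  `|mxip (diag_mx s) W| <= \sum_i s 0 i.
Proof.
move=> s0 hW; rewrite mxip_diag (le_trans (ler_norm_sum _ _ _)) // ler_sum // => i _.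
by rewrite normrM (ger0_norm (s0 i)) ler_piMr // orth_entry_le1.
Qed.

(** Some unit vector [v] is negated by [W], and undoing this sign leaves [Q = W + 2 v v^T].
    Estimates for arbitrary orthogonal matrices thus extend to determinant [-1] with a quadratic
    form in [v] as the correction. *)
Lemma orth_opp_split W : orth W -> \det W = -1 ->
  exists v Q, [/\ dot v v = 1, orth Q, Q *m v = v, W = Q *m refl v &
   forall A, mxip A W = mxip A Q - 2 * dot v (A^T *m v)].
Proof.
move=> hW dW; have [w w0 Ww] := orth_opp_fix hW dW.
pose v := (Num.sqrt (dot w w))^-1 *: w.
have w1 := dot_gt0 w0.
have v1 : dot v v = 1.
  rewrite dotZl dotZr mulrA -invfM -expr2 sqr_sqrtr ?ltW //.
  by rewrite mulVf // gt_eqF.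
have Wv : W *m v = - v by rewrite -scalemxAr Ww scalerN.
have v0 : v != 0 by rewrite -dot_eq0 v1 oner_eq0.
exists v, (W *m refl v); have Qv : W *m refl v *m v = v.
  by rewrite -mulmxA reflv // mulmxN Wv opprK.
split=> //; first exact: orthM (refl_orth _).
  by rewrite -mulmxA reflK mulmx1.
move=> A; rewrite mulmxBr mulmx1 v1 divr1 -scalemxAr mulmxA Wv mxipBr mxipZr.
by rewrite mulNmx mxipNr mxip_outer dotC dot_adj; ring.
Qed.

Lemma dot_diag s v : dot v ((diag_mx s)^T *m v) = \sum_i s 0 i * v i 0 ^+ 2.
Proof.
rewrite dotE tr_diag_mx; apply: eq_bigr => i _.
by rewrite mul_diag_mx mxE expr2 mulrCA.
Qed.

End InnerProduct.

Section Face.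
Variables (R : realType) (n : nat).
Implicit Types (A B C D P Q X Y U V W : 'M[R]_n.+1) (u v : 'cV[R]_n.+1).
Implicit Types (s : 'rV[R]_n.+1) (d : R).

Definition face C : set 'M[R]_n.+1 :=
  [set X | SO X /\ forall Y, SO Y -> mxip C Y <= mxip C X].

Definition signdiag d : 'M[R]_n.+1 :=
  diag_mx (\row_i (if i == ord_max then d else 1)).

(** The trace norm with sign [d] on the smallest singular value: the support function of SO(n) when
    [d] is the product of the determinants of the SVD factors ([svd_le], [svd_face]). *)
Definition signed_sum s d := \sum_i s 0 i - (1 - d) * s 0 ord_max.

Lemma signdiag_orth d : d * d = 1 -> orth (signdiag d).
Proof.
move=> dd; rewrite /orth tr_diag_mx mulmx_diag; apply/matrixP => i j.
rewrite !mxE; have [->|ij] := eqVneq i j; last by rewrite mulr0n.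
by case: ifP => _; rewrite ?dd ?mulr1.
Qed.

Lemma det_signdiag d : \det (signdiag d) = d.
Proof.
rewrite det_diag (bigD1 ord_max) //= mxE eqxx big1 ?mulr1 // => i /negPf h.
by rewrite mxE h.
Qed.

Lemma mxip_signdiag s d : mxip (diag_mx s) (signdiag d) = signed_sum s d.
Proof.
rewrite mxip_diag /signed_sum (bigD1 ord_max) //= [in RHS](bigD1 ord_max) //=.
rewrite !mxE eqxx mulr1n.
rewrite (eq_bigr (s 0)); last by move=> i /negPf h; rewrite !mxE eqxx h mulr1n mulr1.
by ring.
Qed.

Section SortedSpectrum.
Variable s : 'rV[R]_n.+1.
Hypothesis s0 : forall i, 0 <= s 0 i.
Hypothesis s_sorted : forall i j : 'I_n.+1, (i <= j)%N -> s 0 j <= s 0 i.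

Lemma s_min i : s 0 ord_max <= s 0 i.
Proof. by apply: s_sorted; rewrite -ltnS. Qed.

Lemma quad_min v : dot v v = 1 -> s 0 ord_max <= \sum_i s 0 i * v i 0 ^+ 2.
Proof.
rewrite dotE => v1; rewrite -[leLHS]mulr1 -v1 mulr_sumr ler_sum // => i _.
by rewrite -expr2 ler_wpM2r ?sqr_ge0 ?s_min.
Qed.

(** For determinant [-1], [orth_opp_split] gives two terms bounded separately: [Q] contributes at
    most the trace, and the quadratic form at the unit vector [v] is at least the smallest singular
    value. *)
Lemma signed_sum_ge W : orth W -> mxip (diag_mx s) W <= signed_sum s (\det W).
Proof.
move=> hW; rewrite /signed_sum; case: (orth_det hW) => dW; rewrite dW.
  by rewrite subrr mul0r subr0 diag_orth_le.
have [v [Q [v1 hQ _ _ ->]]] := orth_opp_split hW dW.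
rewrite dot_diag opprK -mulr2n mulr_natl [in leRHS]mulr_natl lerB //.
  exact: diag_orth_le.
by rewrite lerMn2r /= quad_min.
Qed.

End SortedSpectrum.

Lemma signed_sum_refl s v : v != 0 ->
  (forall i, s 0 i != s 0 ord_max -> v i 0 = 0) ->
  mxip (diag_mx s) (refl v) = signed_sum s (-1).
Proof.
move=> /dot_gt0 v0 vJ; rewrite mxip_refl mxtrace_diag /signed_sum -{1}[diag_mx s]trmxK.
have -> : dot v ((diag_mx s)^T^T *m v) = s 0 ord_max * dot v v.
  rewrite tr_diag_mx dot_diag dotE mulr_sumr; apply: eq_bigr => i _.
  rewrite -expr2; have [->//|si] := eqVneq (s 0 i) (s 0 ord_max).
  by rewrite vJ // expr0n /= !mulr0.
by field; rewrite gt_eqF.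
Qed.

Section Svd.
Variables (C U V : 'M[R]_n.+1) (s : 'rV[R]_n.+1).
Hypothesis C_svd : is_svd C U s V.

Let d := \det U * \det V.

Lemma svd_sign : d * d = 1.
Proof.
case: C_svd => hU hV _ _ _; rewrite /d mulrACA orth_det_sqr // mul1r.
exact: orth_det_sqr.
Qed.

Lemma svd_SO W : orth W -> \det W = d -> SO (U *m W *m V^T).
Proof.
case: C_svd => hU hV _ _ _ hW dW; split.
  by rewrite -[_ = _]/(orth _); apply: orthM; [exact: orthM|exact: orth_tr].
rewrite !det_mulmx dW det_tr /d mulrA orth_det_sqr // mul1r.
exact: orth_det_sqr.
Qed.

Lemma svd_coord X : SO X ->
  exists W, [/\ orth W, \det W = d & X = U *m W *m V^T].
Proof.
case: C_svd => hU hV _ _ _ [hX dX]; exists (U^T *m X *m V); split.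
- by apply: orthM => //; apply: orthM => //; exact: orth_tr.
- by rewrite !det_mulmx det_tr dX mulr1.
rewrite !mulmxA (mulmx1C hU) mul1mx -mulmxA (mulmx1C hV) mulmx1 //.
Qed.

Lemma svd_mxip W : mxip C (U *m W *m V^T) = mxip (diag_mx s) W.
Proof.
case: C_svd => hU hV _ _ ->.
by rewrite mxip_orthr ?mxip_orthl //; exact: orth_tr.
Qed.

Lemma svd_le X : SO X -> mxip C X <= signed_sum s d.
Proof.
move=> /svd_coord[W [hW <- ->]]; rewrite svd_mxip.
by case: C_svd => _ _ s0 ss _; exact: signed_sum_ge.
Qed.

Lemma svd_face : face C (U *m signdiag d *m V^T).
Proof.
split=> [|Y /svd_le]; first by apply: svd_SO; [exact/signdiag_orth/svd_sign|exact: det_signdiag].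
by rewrite svd_mxip mxip_signdiag.
Qed.

Lemma faceP X : SO X -> mxip C X = signed_sum s d -> face C X.
Proof. by move=> hX e; split=> // Y /svd_le; rewrite e. Qed.

Lemma face_mxip X : face C X -> mxip C X = signed_sum s d.
Proof.
move=> [hX h]; apply/eqP; rewrite eq_le svd_le //=.
by have := h _ svd_face.1; rewrite svd_mxip mxip_signdiag.
Qed.

End Svd.
End Face.

(** * Connectedness of faces *)

Section Connectedness.
Variable R : realType.

(** Multiplying [mxip M (refl w) = c] by [dot w w] removes the denominator. Along the segment from
    [v] to [v'] this leaves a quadratic polynomial with opposite signs at the ends, hence with a
    root. *)
Lemma refl_ivt n (M : 'M[R]_n) (v v' : 'cV[R]_n) c : v != 0 -> v' != 0 ->
  mxip M (refl v) <= c <= mxip M (refl v') ->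
  exists a b, a *: v + b *: v' != 0 /\ mxip M (refl (a *: v + b *: v')) = c.
Proof.
move=> v0 v'0 /andP[cv cv'].
pose psi w := (\tr M - c) * dot w w - 2 * dot w (M *m w).
have psiE w : w != 0 -> psi w = (mxip M (refl w) - c) * dot w w.
  move=> w0; rewrite mxip_refl /psi; field.
  by rewrite dot_eq0.
pose b := 2 * (\tr M - c) * dot v v' - 2 * (dot v (M *m v') + dot v' (M *m v)).
have psi_path t : psi ((1 - t) *: v + t *: v') =
    (1 - t) ^+ 2 * psi v + t * (1 - t) * b + t ^+ 2 * psi v'.
  rewrite /psi /b mulmxDr -!scalemxAr !(dotDl, dotDr, dotZl, dotZr) (dotC v' v).
  by ring.
pose p : {poly R} := (1 - 'X) ^+ 2 * (psi v)%:P + 'X * (1 - 'X) * b%:P + 'X ^+ 2 * (psi v')%:P.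
have pE t : p.[t] = psi ((1 - t) *: v + t *: v').
  by rewrite psi_path /p !hornerE.
have p01 : p.[0] <= 0 <= p.[1].
  rewrite !pE subr0 subrr scale0r addr0 scale1r scale0r add0r scale1r.
  rewrite !psiE // mulr_le0_ge0 ?dot_ge0 ?subr_le0 //=.
  by rewrite mulr_ge0 ?dot_ge0 ?subr_ge0.
have [t /andP[t0 t1] /eqP] := poly_ivt ler01 p01; rewrite pE => rt.
have [w0|w0] := eqVneq ((1 - t) *: v + t *: v') 0; last first.
  exists (1 - t), t; split => //; apply/eqP; rewrite -subr_eq0.
  move: rt; rewrite psiE // => /eqP; rewrite mulf_eq0 dot_eq0 (negPf w0) orbF.
  by [].
(* The root may sit where the segment passes through [0], and there [refl] is not informative. But
   then [v] and [v'] are parallel, their reflections coincide, and both ends already have value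
   [c]. *)
have tn0 : t != 0.
  apply/eqP => tE; move: w0; rewrite tE subr0 scale0r addr0 scale1r => /eqP.
  by rewrite (negPf v0).
have v'E : v' = (- (1 - t) / t) *: v.
  apply: (scalerI tn0); rewrite scalerA mulrCA divff // mulr1 scaleNr.
  by apply/eqP; rewrite -addr_eq0 addrC w0.
have k0 : - (1 - t) / t != 0.
  by apply: contra_neq v'0 => k0; rewrite v'E k0 scale0r.
have rr : refl v' = refl v.
  rewrite v'E; move: (- (1 - t) / t) k0 => k k0.
  have kT : (k *: v)^T = k *: v^T by rewrite linearZ.
  rewrite /refl dotZl dotZr kT -scalemxAl -scalemxAr !scalerA; congr (_ - _ *: _).
  have d0 : dot v v != 0 by rewrite dot_eq0.
  by field; rewrite k0 d0.
exists 1, 0; rewrite scale1r scale0r addr0; split=> //.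
by apply/eqP; rewrite eq_le cv -rr cv'.
Qed.

Section FaceIvt.
Variable n : nat.
Implicit Types (A B C M P Q X Y W : 'M[R]_n) (u v : 'cV[R]_n).

Local Notation basis i := (delta_mx i 0 : 'cV[R]_n).

Lemma basis_dot (i j : 'I_n) : dot (basis i) (basis j) = (i == j)%:R.
Proof.
rewrite dotE (bigD1 i) //= !mxE !eqxx mul1r big1 ?addr0 ?andbT // => k /negPf ki.
by rewrite mxE ki mul0r.
Qed.

Lemma orth_basis_dot W (i j : 'I_n) : orth W ->
  dot (W *m basis i) (W *m basis j) = (i == j)%:R.
Proof. by move=> hW; rewrite dot_orth // basis_dot. Qed.

Lemma basis_ext W Y : (forall i, W *m basis i = Y *m basis i) -> W = Y.
Proof.
move=> h; apply/matrixP => i j; have := h j; rewrite -!colE => /colP/(_ i).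
by rewrite !mxE.
Qed.

(* Two orthogonal matrices with the same determinant which agree on a set of
   basis vectors are joined by a chain of arcs [w |-> refl z' * refl w * W],
   with [w] moving from [z'] to [z]; each arc increases the agreement set. *)
Lemma stabilizer_ivt (J : {set 'I_n}) M W Y c :
  orth W -> orth Y -> \det W = \det Y ->
  (forall i, i \in J -> W *m basis i = Y *m basis i) ->
  mxip M W <= c <= mxip M Y ->
  exists X, [/\ orth X, \det X = \det Y,
    forall i, i \in J -> X *m basis i = Y *m basis i & mxip M X = c].
Proof.
have [k le_k] := ubnP #|~: J|; elim: k => // k IH in J W le_k *.
move=> hW hY dWY WY /andP[cW cY].
have [/existsP[i iP]|/existsPn h] := boolP [exists i, W *m basis i != Y *m basis i];
  last first.
  have WeY : W = Y by apply: basis_ext => i; apply/eqP; have := h i; rewrite negbK.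
  by exists W; split=> //; apply/eqP; rewrite eq_le cW {1}WeY cY.
have iJ : i \notin J by apply: contra iP => /WY ->.
pose z := W *m basis i - Y *m basis i.
have z0 : z != 0 by rewrite subr_eq0.
pose W1 := refl z *m W.
have hW1 : orth W1 by apply: orthM => //; exact: refl_orth.
have W1i : W1 *m basis i = Y *m basis i.
  by rewrite -mulmxA refl_swap // !orth_basis_dot.
have zJ j : j \in J -> dot z (Y *m basis j) = 0.
  move=> jJ; rewrite dotBl -{1}WY // !orth_basis_dot // subrr //.
have W1J j : j \in J -> W1 *m basis j = Y *m basis j.
  by move=> jJ; rewrite -mulmxA WY // refl_fix // zJ.
have dW1 : \det W1 = - \det Y by rewrite det_mulmx det_refl // mulN1r dWY.
(* [W1] has the determinant opposite to that of [Y], so the two must differ on a second basis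
   vector; reflecting there restores the determinant. *)
have [/existsP[j jP]|/existsPn h] := boolP [exists i, W1 *m basis i != Y *m basis i];
  last first.
  have W1eY : W1 = Y by apply: basis_ext => j; apply/eqP; have := h j; rewrite negbK.
  move: dW1; rewrite W1eY => /eqP; rewrite -subr_eq0 opprK -mulr2n -mulr_natr.
  rewrite mulf_eq0 pnatr_eq0 orbF => /eqP d0.
  by have := orth_det_sqr hY; rewrite d0 mulr0 => /eqP; rewrite eq_sym oner_eq0.
pose z' := W1 *m basis j - Y *m basis j.
have z'0 : z' != 0 by rewrite subr_eq0.
have z'P l : W1 *m basis l = Y *m basis l -> dot z' (Y *m basis l) = 0.
  by move=> e; rewrite dotBl -{1}e !orth_basis_dot // subrr.
pose W2 := refl z' *m W1.
have hW2 : orth W2 by apply: orthM => //; exact: refl_orth.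
have dW2 : \det W2 = \det Y by rewrite det_mulmx det_refl // dW1 mulN1r opprK.
have W2J l : l \in i |: J -> W2 *m basis l = Y *m basis l.
  move=> lJ; have e : W1 *m basis l = Y *m basis l.
    by case/finset.setU1P: lJ => [->|/W1J].
  by rewrite -mulmxA e refl_fix // z'P.
(* If [W2] is still below the level, recurse from [W2], which agrees with [Y] on one more vector.
   Otherwise the level is met on the arc, whose ends are [W] (at [w = z'], the two reflections
   cancel) and [W2] (at [w = z]). *)
have [c2|c2] := leP c (mxip M W2); last first.
  have [||X [hX dX XY Xc]] := IH (i |: J) W2 _ hW2 hY dW2 W2J.
  - rewrite ltnS in le_k; apply: leq_trans le_k; rewrite proper_card // finset.properEneq.
    rewrite finset.setCS finset.subsetUr andbT.
    by apply: contraNneq iJ => /finset.setP/(_ i); rewrite !inE eqxx /= => /esym/negbFE.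
  - by rewrite (ltW c2) cY.
  by exists X; split=> // l lJ; apply: XY; rewrite inE lJ orbT.
pose N := refl z' *m M *m W^T.
have NE w : mxip N (refl w) = mxip M (refl z' *m refl w *m W).
  by rewrite mxip_mulr mxip_mull mulmxA refl_tr.
have [|a [b []]] := @refl_ivt _ N z' z c z'0 z0.
  by rewrite !NE reflK mul1mx cW -mulmxA c2.
rewrite NE; set w := _ + _ => w0 wc; exists (refl z' *m refl w *m W); split=> //.
- by apply: orthM => //; apply: orthM; exact: refl_orth.
- by rewrite !det_mulmx !det_refl // mulrNN mul1r mul1r dWY.
move=> l lJ; rewrite -mulmxA WY // -mulmxA [refl w *m _]refl_fix; last first.
  by rewrite /w dotDl !dotZl zJ // z'P ?W1J // !mulr0 addr0.
by rewrite refl_fix // z'P // W1J.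
Qed.

End FaceIvt.

(** In SVD coordinates there are two kinds of faces. If the sign costs nothing ([d = 1] or a zero
    smallest singular value), the face consists of the matrices of determinant [d] fixing every
    basis vector with nonzero singular value: [stabilizer_ivt] applies. Otherwise it consists of
    reflections along vectors of the eigenspace of the smallest singular value: [refl_ivt]
    applies. *)
Lemma face_ivt n (C B U V : 'M[R]_n.+1) s X Y c : is_svd C U s V ->
  face C X -> face C Y -> mxip B X <= c <= mxip B Y ->
  exists2 Z, face C Z & mxip B Z = c.
Proof.
move=> C_svd fX fY.
have [W [hW dW XE]] := svd_coord C_svd fX.1.
have [W' [hW' dW' YE]] := svd_coord C_svd fY.1.
have := face_mxip C_svd fX; have := face_mxip C_svd fY.
rewrite XE YE !(svd_mxip C_svd) => mW' mW.
set M := U^T *m B *m V.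
have ME Q : mxip B (U *m Q *m V^T) = mxip M Q by rewrite mxip_mulr mxip_mull trmxK mulmxA.
rewrite !ME => cP.
suff [Q [hQ dQ Qs Qc]] : exists Q, [/\ orth Q, \det Q = \det U * \det V,
    mxip (diag_mx s) Q = signed_sum s (\det U * \det V) & mxip M Q = c].
  exists (U *m Q *m V^T); last by rewrite ME.
  by apply: (faceP C_svd); [exact: (svd_SO C_svd)|rewrite (svd_mxip C_svd)].
have [hU hV s0 ss _] := C_svd; move: mW mW' dW dW'; set d := _ * _ => mW mW' dW dW'.
have smin := s_min ss.
have diag_eq Q : orth Q -> mxip (diag_mx s) Q = \sum_i s 0 i ->
    forall i, s 0 i != 0 -> Q i i = 1.
  move=> hQ e i si; have /eqP := e; rewrite mxip_diag eq_sym -subr_eq0 -sumrB => h.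
  have nn j : true -> 0 <= s 0 j - s 0 j * Q j j.
    by move=> _; rewrite subr_ge0 ler_piMr // orth_diag_le1.
  have := @psumr_eq0P _ _ _ _ nn (eqP h) i isT.
  rewrite -{1}[s 0 i]mulr1 -mulrBr => /eqP.
  by rewrite mulf_eq0 (negPf si) subr_eq0 => /eqP.
have [sd|sd] := eqVneq ((1 - d) * s 0 ord_max) 0.
  have sE : signed_sum s d = \sum_i s 0 i by rewrite /signed_sum sd subr0.
  rewrite sE in mW mW' *.
  pose J := finset (fun i => s 0 i != 0).
  have [||Q [hQ dQ Qe Qc]] := stabilizer_ivt (J := J) hW hW' _ _ cP.
  - by rewrite dW.
  - by move=> i; rewrite inE => si; rewrite !orth_col_fix // diag_eq.
  exists Q; split=> //; first by rewrite dQ.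
  rewrite mxip_diag; apply: eq_bigr => i _; have [->|si] := eqVneq (s 0 i) 0.
    by rewrite mul0r.
  have := Qe i; rewrite inE (orth_col_fix hW' (diag_eq _ hW' mW' _ si)) -colE => /(_ si)/colP/(_ i).
  by rewrite !mxE !eqxx => ->; rewrite mulr1.
have d1 : d = -1.
  case: (orth_det hW); rewrite dW // => d1.
  by move: sd; rewrite d1 subrr mul0r eqxx.
have sn0 : s 0 ord_max != 0 by apply: contraNneq sd => ->; rewrite mulr0.
have sp i : s 0 i != 0.
  by rewrite gt_eqF // (lt_le_trans _ (smin i)) // lt_def sn0 s0.
(* Equality in [signed_sum_ge] forces equality in both of its terms: the factor [P] is the identity,
   and [v] lives on the smallest singular value. *)
have refl_face Q : orth Q -> \det Q = d -> mxip (diag_mx s) Q = signed_sum s d ->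
    exists v, [/\ dot v v = 1, Q = refl v & forall i, s 0 i != s 0 ord_max -> v i 0 = 0].
  move=> hQ; rewrite d1 => dQ; have [v [P [v1 hP Pv QE Qip]]] := orth_opp_split hQ dQ.
  rewrite Qip dot_diag /signed_sum => e; have qm := quad_min ss v1.
  have Ple := diag_orth_le s0 hP.
  have P1 : P = 1%:M.
    apply: basis_ext => i; rewrite mul1mx orth_col_fix //.
    by apply: diag_eq => //; lra.
  exists v; split=> //; first by rewrite QE P1 mul1mx.
  move=> i si; have e2 : \sum_j (s 0 j - s 0 ord_max) * v j 0 ^+ 2 = 0.
    under eq_bigr do rewrite mulrBl.
    rewrite sumrB -mulr_sumr.
    have -> : \sum_j v j 0 ^+ 2 = 1.
      by rewrite -v1 dotE; apply: eq_bigr => j _; rewrite expr2.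
    lra.
  have nn j : true -> 0 <= (s 0 j - s 0 ord_max) * v j 0 ^+ 2.
    by move=> _; rewrite mulr_ge0 ?sqr_ge0 ?subr_ge0.
  have /eqP := @psumr_eq0P _ _ _ _ nn e2 i isT.
  by rewrite mulf_eq0 subr_eq0 (negPf si) sqrf_eq0 => /eqP.
have [v [v1 WE vJ]] := refl_face _ hW dW mW.
have [v' [v'1 W'E v'J]] := refl_face _ hW' dW' mW'.
have u0 (u : 'cV[R]_n.+1) : dot u u = 1 -> u != 0.
  by move=> u1; rewrite -dot_eq0 u1 oner_eq0.
rewrite WE W'E in cP; have [a [b []]] := refl_ivt (u0 _ v1) (u0 _ v'1) cP.
set w := _ + _ => w0 wc; exists (refl w); split=> //.
- exact: refl_orth.
- by rewrite det_refl.
rewrite d1 signed_sum_refl // => i si.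
by rewrite !mxE vJ // v'J // !mulr0 addr0.
Qed.

End Connectedness.

(** * Sign of the determinant of an orthogonal factor *)

Section Parity.
Variables (R : realType) (n : nat).
Implicit Types (U V Q : 'M[R]_n) (s : 'rV[R]_n).

(* With [Q = U^T V], the orthogonal projection [P] onto the kernel of [1 + Q] is
   read off the SVD, and [Q (1 - 2P)] is orthogonal without eigenvalue [-1]. *)
Lemma svd_parity U V U' V' s : orth U -> orth V -> is_svd (U + V) U' s V' ->
  \det U * \det V = \prod_i (if s 0 i <= 0 then -1 else 1).
Proof.
move=> hU hV [hU' hV' s0 _ UVE].
pose Q := U^T *m V; have hQ : orth Q by apply: orthM => //; exact: orth_tr.
have IQ : 1%:M + Q = U^T *m U' *m diag_mx s *m V'^T.
  by rewrite -!mulmxA (mulmxA U') -UVE mulmxDr hU.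
pose z : 'rV[R]_n := \row_i (if s 0 i <= 0 then 1 else 0).
pose P := V' *m diag_mx z *m V'^T.
have PT : P^T = P by rewrite /P !trmx_mul trmxK tr_diag_mx mulmxA.
have sz : diag_mx s *m diag_mx z = 0.
  rewrite mulmx_diag; apply/matrixP => i j; rewrite !mxE.
  have [h|h] := leP (s 0 i) 0; last by rewrite mulr0 mul0rn.
  by rewrite (le_anti (introT andP (conj h (s0 i)))) mul0r mul0rn.
have zP : (1%:M + Q) *m P = 0.
  by rewrite IQ /P !mulmxA -(mulmxA _ V'^T) hV' mulmx1 -(mulmxA _ (diag_mx s)) sz
    mulmx0 mul0mx.
have QP : Q *m P = - P.
  by apply/eqP; rewrite -addr_eq0 addrC -{1}[P]mul1mx -mulmxDl zP.
have PQ : P *m (1%:M + Q) = 0.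
  have QTP : Q^T *m P = - P.
    by rewrite -[P in RHS]mul1mx -hQ -mulmxA QP mulmxN opprK.
  have : (1%:M + Q)^T *m P = 0.
    by rewrite linearD /= trmx1 mulmxDl mul1mx QTP subrr.
  by move=> /(congr1 trmx); rewrite trmx_mul trmxK PT trmx0.
pose D : 'rV[R]_n := \row_i (if s 0 i <= 0 then -1 else 1).
have DE : 1%:M - 2 *: P = V' *m diag_mx D *m V'^T.
  have -> : diag_mx D = 1%:M - 2 *: diag_mx z.
    apply/matrixP => i j; rewrite !mxE; have [->|ij] := eqVneq i j.
      by rewrite !mulr1n; case: ifP => _; ring.
    by rewrite !mulr0n mulr0 subr0.
  rewrite mulmxBr mulmx1 mulmxBl (mulmx1C hV') -scalemxAr -scalemxAl.
  by [].
have hD : orth (1%:M - 2 *: P).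
  rewrite DE; apply: orthM; last exact: orth_tr.
  apply: orthM => //; rewrite /orth tr_diag_mx mulmx_diag.
  apply/matrixP => i j; rewrite !mxE; case: ifP => _;
    by rewrite ?mulrNN mulr1.
have dD : \det (1%:M - 2 *: P) = \prod_i D 0 i.
  by rewrite DE !det_mulmx det_diag det_tr mulrAC orth_det_sqr // mul1r.
have Q1E : Q *m (1%:M - 2 *: P) = Q + 2 *: P.
  by rewrite mulmxBr mulmx1 -scalemxAr QP scalerN opprK.
(* A kernel vector [x] of [1 + Q + 2 P] satisfies [P x = 0], because [P (1 + Q) = 0] and [P] is
   idempotent; hence [(1 + Q) x = 0]. But [P] is the identity on that kernel, so [x = 0]. *)
have d1 : \det (Q *m (1%:M - 2 *: P)) = 1.
  apply: orth_det1; first exact: orthM.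
  rewrite Q1E addrA unitmxE unitfE -det_tr; apply/negP => /det0P[v v0].
  move=> /(congr1 trmx); rewrite trmx_mul trmxK trmx0; set x := v^T => hx.
  have Px : P *m x = 0.
    have : P *m ((1%:M + Q + 2 *: P) *m x) = 0 by rewrite hx mulmx0.
    rewrite mulmxA mulmxDr PQ add0r -scalemxAr.
    have -> : P *m P = P.
      rewrite /P !mulmxA -(mulmxA _ V'^T V') hV' mulmx1.
      rewrite -(mulmxA V' (diag_mx z) (diag_mx z)) mulmx_diag.
      congr (_ *m diag_mx _ *m _); apply/rowP => i; rewrite !mxE.
      by case: ifP => _; rewrite ?mulr0 ?mulr1.
    by rewrite -scalemxAl => /eqP; rewrite scaler_eq0 pnatr_eq0 /= => /eqP.
  have IQx : (1%:M + Q) *m x = 0.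
    by rewrite mulmxDl -scalemxAl Px scaler0 addr0 in hx.
  pose y := V'^T *m x.
  have sy i : s 0 i * y i 0 = 0.
    have : diag_mx s *m y = 0.
      have : (U'^T *m U) *m ((1%:M + Q) *m x) = 0 by rewrite IQx mulmx0.
      rewrite IQ !mulmxA -(mulmxA _ U) (mulmx1C hU) mulmx1 hU' mul1mx.
      exact.
    by move=> /colP/(_ i); rewrite mul_diag_mx !mxE.
  have zy i : z 0 i * y i 0 = 0.
    have : diag_mx z *m y = 0.
      have : V'^T *m (P *m x) = 0 by rewrite Px mulmx0.
      by rewrite /P !mulmxA hV' mul1mx.
    by move=> /colP/(_ i); rewrite mul_diag_mx !mxE.
  have y0 : y = 0.
    apply/colP => i; move: (sy i) (zy i); rewrite !mxE; case: ifP => [_ _|si /eqP].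
      by rewrite mul1r.
    rewrite mulf_eq0 => /orP[/eqP e|/eqP -> //].
    by rewrite e lexx in si.
  case/negP: v0; rewrite -trmx_eq0 -/x -[x]mul1mx -(mulmx1C hV') -mulmxA -/y y0.
  by rewrite mulmx0.
have -> : \det U * \det V = \det Q by rewrite det_mulmx det_tr.
move: d1; rewrite det_mulmx dD => e.
rewrite (eq_bigr (D 0)); last by move=> i _; rewrite mxE.
have DD : (\prod_i D 0 i) * (\prod_i D 0 i) = 1 by rewrite -dD orth_det_sqr.
by rewrite -[LHS]mulr1 -[X in _ * X = _]DD mulrA e mul1r.
Qed.

End Parity.

(** * Existence of multipliers *)

Section Compactness.
Import numFieldNormedType.Exports.
Variables (R : realType) (n : nat).

Lemma continuous_sum (T : topologicalType) (I : Type) (r : seq I)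
    (f : I -> T -> R) :
  (forall i, continuous (f i)) -> continuous (fun x => \sum_(i <- r) f i x).
Proof. by move=> h; apply: continuous_big => // x; exact: add_continuous. Qed.

Lemma continuous_prod (T : topologicalType) (I : Type) (r : seq I)
    (f : I -> T -> R) :
  (forall i, continuous (f i)) -> continuous (fun x => \prod_(i <- r) f i x).
Proof. by move=> h; apply: continuous_big => // x; exact: mul_continuous. Qed.

Lemma continuous_mul (T : topologicalType) (f g : T -> R) :
  continuous f -> continuous g -> continuous (fun x => f x * g x).
Proof. by move=> hf hg x; apply: continuousM; [exact: hf|exact: hg]. Qed.

Lemma vec_mx_entry_continuous (i j : 'I_n) :
  continuous (fun r : 'rV[R]_(n * n) => vec_mx r i j).
Proof.
have -> : (fun r : 'rV[R]_(n * n) => vec_mx r i j) =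
    (fun r : 'rV[R]_(n * n) => r 0 (mxvec_index i j)).
  by apply/funext => r; rewrite -{2}[r]vec_mxK mxvecE.
exact: coord_continuous.
Qed.

Lemma mxip_vec_continuous (C : 'M[R]_n) :
  continuous (fun r : 'rV[R]_(n * n) => mxip C (vec_mx r)).
Proof.
have -> : (fun r : 'rV[R]_(n * n) => mxip C (vec_mx r)) =
    (fun r => \sum_i \sum_j C i j * vec_mx r i j).
  by apply/funext => r; rewrite mxipE.
apply: continuous_sum => i; apply: continuous_sum => j.
by apply: continuous_mul; [exact: cst_continuous|exact: vec_mx_entry_continuous].
Qed.

Lemma det_vec_continuous : continuous (fun r : 'rV[R]_(n * n) => \det (vec_mx r)).
Proof.
apply: continuous_sum => s; apply: continuous_mul; first exact: cst_continuous.
by apply: continuous_prod => i; exact: vec_mx_entry_continuous.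
Qed.

(** The closed side condition serves twice: to pass to the limit in a family of faces while keeping
    a bound on [y], and, with [D = - B'], to maximize over the face where [B'] is minimal. *)
Lemma SO_max (C D : 'M[R]_n) c : (exists X, SO X /\ c <= mxip D X) ->
  exists X, [/\ SO X, c <= mxip D X &
    forall Y, SO Y -> c <= mxip D Y -> mxip C Y <= mxip C X].
Proof.
move=> [X0 [X0SO X0c]].
pose K := [set r : 'rV[R]_(n * n) | SO (vec_mx r) /\ c <= mxip D (vec_mx r)].
have Kcl : closed K.
  have -> : K = \bigcap_ij ((fun r => ((vec_mx r)^T *m vec_mx r) ij.1 ij.2) @^-1`
        [set x | x = (1%:M : 'M[R]_n) ij.1 ij.2]) `&`
      ((fun r => \det (vec_mx r)) @^-1` [set x | x = 1]) `&`
      ((fun r => mxip D (vec_mx r)) @^-1` [set x | c <= x]).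
    apply/seteqP; split => r /=.
      by move=> [[h d] ?]; split=> //; split=> // ij _; rewrite /= h.
    move=> [[h d] ?]; split=> //; split=> //; apply/matrixP => i j.
    exact: (h (i, j)).
  apply: closedI; last first.
    by refine ((continuous_closedP _).1 (@mxip_vec_continuous D) _ _); exact: closed_ge.
  apply: closedI; last first.
    by refine ((continuous_closedP _).1 det_vec_continuous _ _); exact: closed_eq.
  apply: closed_bigI => -[i j] _ /=.
  refine ((continuous_closedP _).1 _ _ _); last exact: closed_eq.
  have -> : (fun r : 'rV[R]_(n * n) => ((vec_mx r)^T *m vec_mx r) i j) =
      (fun r => \sum_k vec_mx r k i * vec_mx r k j).
    by apply/funext => r; rewrite mxE; apply: eq_bigr => k _; rewrite mxE.
  apply: continuous_sum => k; apply: continuous_mul; exact: vec_mx_entry_continuous.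
have Kco : compact K.
  have box : compact [set v : 'rV[R]_(n * n) | forall i, v ord0 i \in `[(-1 : R), 1]].
    apply: (@rV_compact _ _ (fun=> `[(-1 : R), 1]%classic)).
    by move=> _; apply: segment_compact.
  apply: subclosed_compact Kcl box _ => r [[hr _] _] k.
  rewrite -[r]vec_mxK; case/mxvec_indexP: k => i j; rewrite mxvecE.
  by rewrite in_itv /= -ler_norml orth_entry_le1.
have K0 : K !=set0 by exists (mxvec X0); rewrite /K /= mxvecK.
have cont : {within K, continuous (fun r => mxip C (vec_mx r))}.
  by apply: continuous_subspaceT; exact: mxip_vec_continuous.
have [r /set_mem [rSO rc] rmax] := compact_EVT_max K0 Kco cont.
exists (vec_mx r); split=> // Y YSO Yc.
by have := rmax (mxvec Y); rewrite mxvecK; apply; rewrite inE /K /= mxvecK.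
Qed.

End Compactness.

Section Multiplier.
Variables (R : realType) (n : nat).
Implicit Types (A B X Y : 'M[R]_n.+1).

Hypothesis has_svd : forall C : 'M[R]_n.+1, exists U s V, is_svd C U s V.

Lemma face_nonempty (C : 'M[R]_n.+1) : exists X, face C X.
Proof. by have [U [s [V /svd_face]]] := has_svd C; eexists; eauto. Qed.

(** Let [ls] be the supremum of the multipliers in [[0, L]] having a maximizer with [y >= b]. Limits
    from below and from above give maximizers at [ls] on both sides of the level, and [face_ivt]
    joins them. *)
Lemma multiplier_exists A B b delta X0 XA :
  (forall X, SO X -> `|mxip A X| <= 1) -> (forall X, SO X -> `|mxip B X| <= 1) ->
  0 < delta -> SO X0 -> mxip B X0 = b - delta ->
  face A XA -> b <= mxip B XA ->
  exists lam X, [/\ 0 <= lam <= 2 / delta, face (A - lam *: B) X & mxip B X = b].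
Proof.
move=> A1 B1 d0 X0SO X0b XAf XAb.
pose L := 2 / delta; have L0 : 0 <= L by rewrite divr_ge0 // ltW.
pose E := [set l : R | 0 <= l <= L /\ exists2 X, face (A - l *: B) X & b <= mxip B X].
have ipE l X : mxip (A - l *: B) X = mxip A X - l * mxip B X.
  by rewrite mxipBl mxipZl.
have E0 : E 0 by split; [rewrite lexx|exists XA => //; rewrite scale0r subr0].
have Esup : has_sup E.
  by split; [exists 0|exists L => x [/andP[]]].
pose ls := sup E.
have ls_ub x : E x -> x <= ls by move=> Ex; exact: sup_upper_bound.
have ls0 : 0 <= ls by exact: ls_ub.
have lsL : ls <= L by apply: ge_sup; [exists 0|move=> x [/andP[]]].
(* Faces are upper semicontinuous in the multiplier. Since [|y| <= 1], moving the multiplier by less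
   than [g / 2] changes the difference of two penalized values by less than [g], too little to make
   up for a gap [g]. *)
have near_face D c X l :
    (forall e, 0 < e -> exists2 m, `|m - l| < e &
       exists2 Y, face (A - m *: B) Y & c <= mxip D Y) ->
    exists2 Y, face (A - l *: B) Y & c <= mxip D Y.
  move=> h; have [|Y [YSO Yc Ymax]] := @SO_max R n.+1 (A - l *: B) D c.
    by have [m _ [Y [YSO _] Yc]] := h 1 ltr01; exists Y.
  exists Y => //; split=> // Z ZSO; rewrite leNgt; apply/negP => lt.
  pose g := mxip (A - l *: B) Z - mxip (A - l *: B) Y.
  have g0 : 0 < g by rewrite subr_gt0.
  have [|m ml [W [WSO Wmax] Wc]] := h (g / 2); first by rewrite divr_gt0.
  have := Ymax W WSO Wc; have := Wmax Z ZSO; rewrite /g in g0 ml; rewrite !ipE in g0 ml *.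
  have /ler_normlP[w1 w2] := B1 _ WSO; have /ler_normlP[z1 z2] := B1 _ ZSO.
  move: ml; rewrite ltr_norml => /andP[m1 m2].
  move: (mxip A Z) (mxip B Z) (mxip A Y) (mxip B Y) (mxip A W) (mxip B W)
    z1 z2 w1 w2 m1 m2 g0 => az bz ay by' aw bw z1 z2 w1 w2 m1 m2 g0 h1 h2.
  have : (m - l) * (bz - bw) < az - l * bz - (ay - l * by').
    have [ml|ml] := leP 0 (m - l).
      have : (m - l) * (bz - bw) <= (m - l) * 2 by rewrite ler_wpM2l //; lra.
      lra.
    have : (m - l) * (bz - bw) <= (m - l) * (- 2) by rewrite ler_wnM2l ?(ltW ml) //; lra.
    lra.
  lra.
have [X1 X1f X1b] : exists2 X, face (A - ls *: B) X & b <= mxip B X.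
  apply: near_face => // e e0; have [m Em mls] := sup_adherent e0 Esup.
  exists m; last by case: Em.
  by have := ls_ub _ Em; rewrite ltr_norml; rewrite -/ls in mls; lra.
have [X2 X2f X2b] : exists2 X, face (A - ls *: B) X & - b <= mxip (- B) X.
  (* The origin of [L = 2 / delta]: comparison with [X0] gives
     [L * (y - b + delta) <= 2 = L * delta], since [x] varies by at most [2]; so at [L] a maximizer
     has [y <= b]. *)
  have [lsE|lsE] := eqVneq ls L.
    exists X1 => //; rewrite mxipNl lerN2; case: X1f => X1SO /(_ _ X0SO).
    rewrite !ipE lsE X0b => h.
    have /ler_normlP[_ a1] := A1 _ X1SO; have /ler_normlP[a0 _] := A1 _ X0SO.
    have : L * (mxip B X1 - b) <= 0.
      have : L * delta = 2 by rewrite divfK ?gt_eqF.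
      lra.
    by rewrite pmulr_rle0 ?subr_le0 // divr_gt0.
  apply: near_face => // e e0.
  have lsL' : ls < L by rewrite lt_def eq_sym lsE.
  pose m := Num.min L (ls + e / 2).
  have mls : ls < m by rewrite lt_min lsL' /= ltrDl divr_gt0.
  exists m.
    have : m <= ls + e / 2 by rewrite ge_min lexx orbT.
    by rewrite ltr_norml; lra.
  have [X Xf] := face_nonempty (A - m *: B); exists X => //.
  rewrite mxipNl lerN2 leNgt; apply/negP => bX.
  have : E m.
    split; last by exists X => //; exact: ltW.
    by rewrite (le_trans ls0 (ltW mls)) /= ge_min lexx.
  by move=> /ls_ub; rewrite leNgt mls.
rewrite mxipNl lerN2 in X2b.
have [U [s [V svdE]]] := has_svd (A - ls *: B).
have [|X Xf Xb] := face_ivt (B := B) (c := b) svdE X2f X1f; first by rewrite X2b.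
by exists ls, X; split=> //; rewrite ls0.
Qed.

End Multiplier.

(** * Quadratic growth away from a face *)

Section Gap.
Variable R : realType.

Section Rotation.
Variable n : nat.
Implicit Types (A Y : 'M[R]_n).

Local Notation basis i := (delta_mx i 0 : 'cV[R]_n).

Lemma dot_basis i (v : 'cV[R]_n) : dot (basis i) v = v i 0.
Proof.
rewrite dotE (bigD1 i) //= mxE !eqxx mul1r big1 ?addr0 // => k /negPf ki.
by rewrite mxE ki mul0r.
Qed.

Lemma dot_basis_col i j Y : dot (basis i) (Y *m basis j) = Y i j.
Proof. by rewrite dot_basis -colE mxE. Qed.

(* [Y1] is [Y] followed by the rotation in the plane of [e_i] and [Y e_i] which
   takes [Y e_i] back to [e_i]. *)
Lemma rotate_column Y i : orth Y -> -1 < Y i i ->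
  exists Y1, [/\ orth Y1, \det Y1 = \det Y,
    forall j, j = i \/ Y *m basis j = basis j -> Y1 *m basis j = basis j,
    forall j, j != i -> Y1 j j = Y j j - Y i j * Y j i / (1 + Y i i) &
    mxip Y Y1 = n%:R - 2 * (1 - Y i i)].
Proof.
move=> hY Yi; pose u := Y *m basis i; pose f := u + basis i.
have Yi0 : 0 < 1 + Y i i by rewrite -ltrBlDl sub0r.
have uu : dot u u = 1 by rewrite /u orth_basis_dot // eqxx.
have ee : dot (basis i) (basis i) = 1 by rewrite basis_dot eqxx.
have ff : dot f f = 2 * (1 + Y i i).
  rewrite /f !dotDl !dotDr uu ee (dotC u) dot_basis_col; ring.
have fu : dot f u = 1 + Y i i by rewrite dotDl uu dot_basis_col.
have f0 : f != 0 by rewrite -dot_eq0 ff mulf_neq0 // ?pnatr_eq0 // gt_eqF.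
have e0 : basis i != 0 by rewrite -dot_eq0 ee oner_eq0.
pose Y1 := refl f *m Y *m refl (basis i).
have Y1i : Y1 *m basis i = basis i.
  rewrite /Y1 -mulmxA reflv // mulmxN -mulmxA -/u refl_mul fu ff.
  have -> : 2 * (1 + Y i i) / (2 * (1 + Y i i)) = 1.
    by rewrite divff // mulf_neq0 ?pnatr_eq0 // gt_eqF.
  by rewrite scale1r opprB /f addrAC subrr add0r.
have Y1j j : j != i -> Y1 *m basis j = refl f *m (Y *m basis j).
  move=> ji; rewrite /Y1 -mulmxA refl_fix ?mulmxA //.
  by rewrite basis_dot eq_sym (negPf ji).
have fe j : j != i -> dot f (basis j) = Y j i.
  by move=> ji; rewrite dotDl basis_dot eq_sym (negPf ji) addr0 dotC dot_basis_col.
have fY j : j != i -> dot f (Y *m basis j) = Y i j.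
  by move=> ji; rewrite dotDl dot_basis_col orth_basis_dot // eq_sym (negPf ji) add0r.
exists Y1; split.
- by apply: orthM; [apply: orthM => //|]; exact: refl_orth.
- by rewrite !det_mulmx !det_refl // mulN1r mulrN1 opprK.
- move=> j; have [->|ji] := eqVneq j i; first by rewrite Y1i.
  case=> [e|Yj]; first by rewrite e eqxx in ji.
  rewrite Y1j // Yj refl_fix // dotDl basis_dot [i == j]eq_sym (negPf ji) addr0.
  by rewrite -Yj orth_basis_dot // eq_sym (negPf ji).
- move=> j ji; rewrite -(dot_basis_col j j Y1) Y1j // refl_mul dotBr dotZr.
  rewrite dot_basis_col fY // (dotC _ f) fe // ff.
  by field; rewrite gt_eqF.
rewrite /Y1 mxip_mulr refl_tr.
have -> : Y *m refl (basis i) = Y - 2 *: (u *m (basis i)^T).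
  by rewrite mulmxBr mulmx1 ee divr1 -scalemxAr mulmxA.
have -> : refl f *m Y = Y - (1 + Y i i)^-1 *: (f *m (Y^T *m f)^T).
  rewrite mulmxBl mul1mx -scalemxAl trmx_mul trmxK mulmxA ff.
  by rewrite invfM mulrA divff ?mul1r // pnatr_eq0.
rewrite mxipBl !mxipBr !mxipZl !mxipZr mxip_orth // [mxip _ Y]mxipC !mxip_outer.
rewrite -/u uu mulmxA (mulmx1C hY) mul1mx ff.
have -> : dot f (u *m (basis i)^T *m (Y^T *m f)) = (1 + Y i i) * (1 + Y i i).
  rewrite -mulmxA (mx11_scalar (_ *m (Y^T *m f))) mul_mx_scalar dotZr fu; congr (_ * _).
  by rewrite -[LHS]/(dot _ _) dotC dot_adj trmxK.
by field; rewrite gt_eqF.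
Qed.

(** The columns of [J] are straightened one by one, those of [K] being done already. Each rotation
    moves [Y] by a squared distance [4 * (1 - Y i i)] and does not increase the total defect, so
    AM-GM charges at most [e + S / e] per column. *)
Lemma rotate_near (J K : {set 'I_n}) A Y e : 0 < e -> mxip A A <= 1 -> orth Y ->
  (forall j, j \in K -> Y *m basis j = basis j) ->
  \sum_(j in J) (1 - Y j j) < 1 ->
  exists Y0, [/\ orth Y0, \det Y0 = \det Y,
    forall j, j \in J :|: K -> Y0 *m basis j = basis j &
    mxip A Y <= mxip A Y0 + #|J|%:R * (e + (\sum_(j in J) (1 - Y j j)) / e)].
Proof.
move=> e0 A1; have [k] := ubnP #|J|; elim: k => // k IH in J K Y * => Jk hY YK.
have [->|/set0Pn[i iJ]] := eqVneq J finset.set0.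
  move=> _; exists Y; split=> //; first by move=> j; rewrite finset.set0U => /YK.
  by rewrite cards0 mul0r addr0.
set S := \sum_(j in J) _ => S1.
have d0 j : 0 <= 1 - Y j j by rewrite subr_ge0 orth_diag_le1.
have SE : S = (1 - Y i i) + \sum_(j in J :\ i) (1 - Y j j).
  by rewrite /S (big_setD1 i).
have dS : 1 - Y i i <= S by rewrite SE lerDl sumr_ge0.
have Yi : 0 < Y i i by lra.
have [|Y1 [hY1 dY1 Y1fix Y1d Y1ip]] := @rotate_column Y i hY; first by lra.
have S1le : \sum_(j in J :\ i) (1 - Y1 j j) <= S.
  (* The products are bounded by half sums of squares in row and column [i], each summing to at most
     [1 - Y i i ^+ 2], which factors through the denominator [1 + Y i i]. So the remaining columns
     lose at most the defect that column [i] has just released. *)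
  have cross : \sum_(j in J :\ i) Y i j * Y j i / (1 + Y i i) <= 1 - Y i i.
    have sq (Z : 'M[R]_n) : orth Z -> \sum_(j in J :\ i) Z j i ^+ 2 <= 1 - Z i i ^+ 2.
      move=> hZ; have e1 : \sum_j Z^T i j * Z j i = 1.
        by have /matrixP/(_ i i) := hZ; rewrite !mxE eqxx.
      rewrite lerBrDl -[leRHS]e1 [leRHS](bigD1 i) //= mxE expr2 lerD2l.
      rewrite [leRHS](bigID (fun j => j \in J :\ i)) /= -[leLHS]addr0 lerD //.
        rewrite [leRHS](eq_bigl (fun j => j \in J :\ i)).
          by apply: ler_sum => j _; rewrite mxE expr2.
        by move=> j; rewrite in_setD1 andbA andbb.
      by rewrite sumr_ge0 // => j _; rewrite mxE -expr2 sqr_ge0.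
    have h1 := sq _ hY; have h2 := sq _ (orth_tr hY); rewrite !mxE in h2.
    rewrite -mulr_suml ler_pdivrMr; last by lra.
    have : \sum_(j in J :\ i) Y i j * Y j i <=
        2^-1 * \sum_(j in J :\ i) Y j i ^+ 2 + 2^-1 * \sum_(j in J :\ i) Y^T j i ^+ 2.
      rewrite !mulr_sumr -big_split /= ler_sum // => j _; rewrite mxE.
      have := sqr_ge0 (Y i j - Y j i); rewrite !expr2; lra.
    move=> h; apply: le_trans h _; rewrite !expr2 in h1 h2 *; lra.
  rewrite SE (eq_bigr (fun j => (1 - Y j j) + Y i j * Y j i / (1 + Y i i))).
    by rewrite big_split /= [leRHS]addrC lerD2l.
  by move=> j; rewrite in_setD1 => /andP[ji _]; rewrite Y1d //; ring.
have [||||Y0 [hY0 dY0 Y0fix Y0ip]] := IH (J :\ i) (i |: K) Y1.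
- by rewrite ltnS in Jk; apply: leq_trans Jk; rewrite [leqRHS](cardsD1 i) iJ.
- by [].
- by move=> j /finset.setU1P[->|/YK]; [exact: Y1fix (or_introl _)|move=> ?; apply: Y1fix; right].
- exact: le_lt_trans S1le S1.
exists Y0; split=> //; first by rewrite dY0.
  move=> j jJK; apply: Y0fix; move: jJK; rewrite !inE.
  by case: (j == i) => //=; rewrite orbT.
have Jc : #|J|%:R = 1 + #|J :\ i|%:R :> R by rewrite (cardsD1 i J) iJ natrD.
have step : mxip A Y - mxip A Y1 <= e + S / e.
  rewrite -mxipBr; apply: le_trans (mxip_am_gm _ _ e0) _; rewrite lerD //.
    by rewrite ler_piMr // ltW.
  rewrite mxip_orth_sub // Y1ip.
  have -> : (2 * n%:R - 2 * (n%:R - 2 * (1 - Y i i))) / (4 * e) = (1 - Y i i) / e.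
    by field; rewrite gt_eqF.
  by rewrite ler_pM2r ?invr_gt0.
have tail : #|J :\ i|%:R * (e + (\sum_(j in J :\ i) (1 - Y1 j j)) / e) <=
    #|J :\ i|%:R * (e + S / e).
  by rewrite ler_wpM2l // lerD2l ler_pM2r ?invr_gt0.
rewrite Jc; lra.
Qed.

End Rotation.

Section FaceGap.
Variable n : nat.
Hypothesis n2 : (1 < n)%N.
Implicit Types (A C U V X W : 'M[R]_n.+1) (s : 'rV[R]_n.+1).

(* Terms with a vanishing denominator contribute [0]. *)
Definition inv_gap s : R :=
  \sum_i ((s 0 i)^-1 + (s 0 i - s 0 ord_max)^-1).

(** A sum of inverses dominates each of them, so it can stand for the inverse of the smallest
    positive gap without any search for that gap. *)
Lemma inv_gap_ge s i : (forall i, 0 <= s 0 i) ->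
    (forall i j : 'I_n.+1, (i <= j)%N -> s 0 j <= s 0 i) ->
  [/\ 0 <= inv_gap s, (s 0 i)^-1 <= inv_gap s &
      (s 0 i - s 0 ord_max)^-1 <= inv_gap s].
Proof.
move=> s0 ss.
have a j : 0 <= (s 0 j)^-1 by rewrite invr_ge0.
have b j : 0 <= (s 0 j - s 0 ord_max)^-1 by rewrite invr_ge0 subr_ge0 s_min.
have c j : 0 <= (s 0 j)^-1 + (s 0 j - s 0 ord_max)^-1 by rewrite addr_ge0.
split; first by rewrite sumr_ge0.
  by rewrite /inv_gap (bigD1 i) //= -[leLHS]addr0 -addrA lerD2l addr_ge0 // sumr_ge0.
rewrite /inv_gap (bigD1 i) //= addrAC -[leLHS]add0r lerD2r addr_ge0 // sumr_ge0 //.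
Qed.

(** The squared distance from [X] to a suitable point of the face is bounded through [inv_gap s] by
    the deficit of [C] at [X], and [mxip_am_gm] converts this into the stated bound. The same two
    kinds of faces occur as in [face_ivt]. *)
Lemma face_gap A C U s V eps X : is_svd C U s V ->
  (forall X, orth X -> `|mxip A X| <= 1) -> mxip A A <= 1 ->
  0 < eps <= 1 -> SO X ->
  exists2 X0, face C X0 & mxip A X <= mxip A X0 + eps +
     n.+1%:R ^+ 2 * inv_gap s / eps * (mxip C X0 - mxip C X).
Proof.
move=> C_svd A1 AA /andP[e0 e1] XSO.
have [W [hW dW XE]] := svd_coord C_svd XSO.
have [hU hV s0 ss _] := C_svd.
set M := U^T *m A *m V.
have ME Q : mxip A (U *m Q *m V^T) = mxip M Q by rewrite mxip_mulr mxip_mull trmxK mulmxA.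
have M1 Q : orth Q -> `|mxip M Q| <= 1.
  by move=> hQ; rewrite -ME A1 //; apply: orthM; [exact: orthM|exact: orth_tr].
have MM : mxip M M <= 1.
  by rewrite mxip_orthr // mxip_orthl //; exact: orth_tr.
have smin := s_min ss; have [g0 _ _] := inv_gap_ge ord_max s0 ss.
have gi i : (s 0 i)^-1 <= inv_gap s by have [] := inv_gap_ge i s0 ss.
have gd i : (s 0 i - s 0 ord_max)^-1 <= inv_gap s by have [] := inv_gap_ge i s0 ss.
set d := \det U * \det V in dW.
set G := inv_gap s in g0 gi gd *.
have scale_le x y : 0 <= x -> (0 <= y -> x^-1 <= G -> (x != 0 -> y <= G * (x * y))).
  move=> x0 y0 xG xn0; rewrite mulrA ler_peMl //.
  have xp : 0 < x by rewrite lt_def xn0.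
  by rewrite -(mulVf xn0) ler_pM2r.
suff [W0 [hW0 dW0 W0s W0ip]] : exists W0, [/\ orth W0, \det W0 = d,
    mxip (diag_mx s) W0 = signed_sum s d &
    mxip M W <= mxip M W0 + eps +
      n.+1%:R ^+ 2 * G / eps * (signed_sum s d - mxip (diag_mx s) W)].
  exists (U *m W0 *m V^T).
    by apply: (faceP C_svd); [exact: (svd_SO C_svd)|rewrite (svd_mxip C_svd)].
  by rewrite XE !ME !(svd_mxip C_svd) W0s.
have n21 : 2 <= n.+1%:R ^+ 2 :> R.
  by rewrite -natrX ler_nat (leq_trans (_ : 2 <= 2 ^ 2)%N) // leq_sqr (leq_trans n2).
have [sd|sd] := eqVneq ((1 - d) * s 0 ord_max) 0.
  have sE : signed_sum s d = \sum_i s 0 i by rewrite /signed_sum sd subr0.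
  rewrite sE.
  pose J := finset (fun i => s 0 i != 0).
  set S := \sum_(i in J) (1 - W i i).
  have SG : S <= G * (\sum_i s 0 i - mxip (diag_mx s) W).
    rewrite mxip_diag -sumrB mulr_sumr [leRHS](bigID (fun i => i \in J)) /=.
    rewrite -[leLHS]addr0 lerD //.
      apply: ler_sum => i; rewrite inE => si.
      rewrite -{1}[s 0 i]mulr1 -mulrBr scale_le // subr_ge0 orth_diag_le1 //.
    rewrite sumr_ge0 // => i _; rewrite mulr_ge0 // subr_ge0 ler_piMr //.
    exact: orth_diag_le1.
  have S0 : 0 <= S by rewrite sumr_ge0 // => i _; rewrite subr_ge0 orth_diag_le1.
  have face_of Q : (forall i, i \in J -> Q *m delta_mx i 0 = delta_mx i 0 :> 'cV_n.+1) ->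
      mxip (diag_mx s) Q = \sum_i s 0 i.
    move=> QJ; rewrite mxip_diag; apply: eq_bigr => i _.
    have [->|si] := eqVneq (s 0 i) 0; first by rewrite mul0r.
    have := QJ i; rewrite inE => /(_ si); rewrite -colE => /colP/(_ i).
    by rewrite !mxE !eqxx => ->; rewrite mulr1.
  have coef y : 0 <= y -> y <= G * (\sum_i s 0 i - mxip (diag_mx s) W) ->
     n.+1%:R ^+ 2 / eps * y <=
     n.+1%:R ^+ 2 * G / eps * (\sum_i s 0 i - mxip (diag_mx s) W).
    move=> y0 yG; rewrite [n.+1%:R ^+ 2 * G / _]mulrAC -[leRHS]mulrA ler_wpM2l //.
    by rewrite divr_ge0 ?sqr_ge0 // ltW.
  (* Far from the face nothing has to be moved: the last term is at least [n.+1 ^ 2 >= 2], the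
     largest possible variation of [A], so any point of the face will do. *)
  have [S1|S1] := leP 1 S.
    have dd := svd_sign C_svd.
    exists (signdiag n d); split; rewrite ?det_signdiag ?mxip_signdiag //.
      exact: signdiag_orth.
    have /ler_normlP[_ h1] := M1 _ hW.
    have /ler_normlP[h2 _] := M1 _ (signdiag_orth n dd).
    have h3 := coef _ S0 SG.
    have h4 : n.+1%:R ^+ 2 <= n.+1%:R ^+ 2 / eps * S :> R.
      rewrite -mulrA ler_peMr ?sqr_ge0 // mulrC ler_pdivlMr // mul1r.
      exact: le_trans S1.
    lra.
  (* At most [n.+1] rotations at precision [eps / n.+1] cost [eps] in total; the inverse of this
     precision is the source of the square of [n.+1]. *)
  have en0 : 0 < eps / n.+1%:R by rewrite divr_gt0.
  have W0 j : j \in (finset.set0 : {set 'I_n.+1}) ->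
    W *m delta_mx j 0 = delta_mx j 0 :> 'cV_n.+1 by rewrite inE.
  have [Y [hY dY Yfix Yip]] := rotate_near en0 MM hW W0 S1.
  exists Y; split=> //; first by rewrite dY.
    by apply: face_of => i iJ; apply: Yfix; rewrite inE iJ.
  apply: le_trans Yip _; rewrite -addrA lerD2l.
  have card_le : #|J|%:R <= n.+1%:R :> R by rewrite ler_nat -[leqRHS]card_ord max_card.
  rewrite -/S; apply: le_trans (_ : n.+1%:R * (eps / n.+1%:R + S / (eps / n.+1%:R)) <= _).
    by rewrite ler_wpM2r // addr_ge0 ?(ltW en0) // divr_ge0 // ltW.
  have -> : n.+1%:R * (eps / n.+1%:R + S / (eps / n.+1%:R)) =
     eps + n.+1%:R ^+ 2 / eps * S :> R.
    field; rewrite gt_eqF //= addrC natr1 pnatr_eq0 //.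
  by rewrite lerD2l coef.
have d1 : d = -1.
  case: (orth_det hW); rewrite dW // => d1.
  by move: sd; rewrite d1 subrr mul0r eqxx.
have sn0 : s 0 ord_max != 0 by apply: contraNneq sd => ->; rewrite mulr0.
have sp i : s 0 i != 0.
  by rewrite gt_eqF // (lt_le_trans _ (smin i)) // lt_def sn0 s0.
have [v [Q [v1 hQ _ WE Wip]]] := orth_opp_split hW (etrans dW d1).
pose J := finset (fun i => s 0 i == s 0 ord_max).
pose vJ : 'cV[R]_n.+1 := \col_i (if i \in J then v i 0 else 0).
(* The nearest reflection in the face: [v] projected to the eigenspace of the smallest singular
   value, or any vector of that eigenspace if the projection vanishes. [T] is the squared norm of
   the discarded part. *)
pose w : 'cV[R]_n.+1 := if vJ == 0 then delta_mx ord_max 0 else vJ.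
have w0 : w != 0.
  rewrite /w; case: ifPn => // _; rewrite -dot_eq0 basis_dot eqxx.
  exact: oner_neq0.
have wJ i : i \notin J -> w i 0 = 0.
  move=> iJ; rewrite /w; case: ifP => _; last by rewrite mxE (negPf iJ).
  rewrite mxE; case: eqP => // iE; case/negP: iJ; rewrite iE inE //.
pose T := \sum_(i in ~: J) v i 0 ^+ 2.
have T0 : 0 <= T by rewrite sumr_ge0 // => i _; rewrite sqr_ge0.
have vsum : \sum_i v i 0 ^+ 2 = 1.
  by rewrite -v1 dotE; apply: eq_bigr => i _; rewrite expr2.
have vJ1 : dot vJ vJ = 1 - T.
  rewrite -vsum (bigID (fun i => i \in J)) /= /T.
  rewrite [X in _ - X](eq_bigl (fun i => i \notin J)); last by move=> i; rewrite inE.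
  rewrite addrK dotE big_mkcond [RHS]big_mkcond /=; apply: eq_bigr => i _; rewrite mxE.
  by case: ifP; rewrite ?mul0r // expr2.
have vw : dot v w * dot v w = (1 - T) * dot w w.
  rewrite /w; case: ifPn => [/eqP vJ0|_].
    have T1 : 1 - T = 0 by rewrite -vJ1 vJ0 dotE big1 // => i _; rewrite mxE mul0r.
    rewrite T1 mul0r dotC dot_basis.
    have : vJ ord_max 0 = 0 by rewrite vJ0 mxE.
    by rewrite mxE inE eqxx => ->; rewrite mul0r.
  suff -> : dot v vJ = dot vJ vJ by rewrite vJ1.
  rewrite !dotE; apply: eq_bigr => i _; rewrite mxE; case: ifP; rewrite ?mulr0 ?mul0r //.
have dvw : mxip (refl v - refl w) (refl v - refl w) = 8 * T.
  rewrite mxip_orth_sub; try exact: refl_orth.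
  rewrite mxip_refl -mxip1 mxip_refl mul1mx v1 mxtrace1 refl_mul v1 !divr1 dotBr dotZr.
  rewrite (dotC w v).
  have -> : 2 * dot v w * dot v w = 2 * ((1 - T) * dot w w) by rewrite -mulrA vw.
  field.
  by rewrite dot_eq0.
pose e1' := \sum_i s 0 i - mxip (diag_mx s) Q.
pose e2' := \sum_i s 0 i * v i 0 ^+ 2 - s 0 ord_max.
have eta : signed_sum s d - mxip (diag_mx s) W = e1' + 2 * e2'.
  by rewrite Wip dot_diag /signed_sum d1 /e1' /e2'; ring.
have Qle : mxip ((Q - 1%:M) *m refl v) ((Q - 1%:M) *m refl v) <= 2 * (G * e1').
  rewrite mxip_orthr; last exact: refl_orth.
  rewrite mxip_orth_sub //; last by rewrite /orth trmx1 mul1mx.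
  rewrite mxipC mxip1 -mulrBr ler_pM2l // -[n.+1%:R](mxtrace1 R n.+1) /e1' mxip_diag.
  rewrite -!sumrB mulr_sumr ler_sum // => i _; rewrite mxE eqxx.
  rewrite -{1}[s 0 i]mulr1 -mulrBr scale_le // subr_ge0 orth_diag_le1 //.
have Tle : T <= G * e2'.
  have -> : e2' = \sum_i (s 0 i - s 0 ord_max) * v i 0 ^+ 2.
    under eq_bigr do rewrite mulrBl.
    by rewrite sumrB -mulr_sumr vsum mulr1.
  rewrite /T mulr_sumr [leRHS](bigID (fun i => i \in ~: J)) /= -[leLHS]addr0 lerD //.
    apply: ler_sum => i; rewrite !inE => si.
    by rewrite scale_le ?sqr_ge0 ?subr_ge0 // subr_eq0.
  by rewrite sumr_ge0 // => i _; rewrite mulr_ge0 // mulr_ge0 ?sqr_ge0 ?subr_ge0.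
exists (refl w); split.
- exact: refl_orth.
- by rewrite det_refl.
- rewrite d1 signed_sum_refl // => i si; apply: wJ; rewrite inE //.
(* The move from [W] to [refl w] passes through [refl v]. Each half is charged [eps / 2], and its
   squared length is controlled by one of the two parts [e1'], [e2'] of the deficit. *)
have e02 : 0 < eps / 2 by rewrite divr_gt0.
have := mxip_am_gm M ((Q - 1%:M) *m refl v) e02.
have := mxip_am_gm M (refl v - refl w) e02.
have -> : mxip M ((Q - 1%:M) *m refl v) = mxip M W - mxip M (refl v).
  by rewrite mulmxBl mul1mx -WE mxipBr.
rewrite dvw (mxipBr M (refl v)) eta => i1 i2.
have MM2 : eps / 2 * mxip M M <= eps / 2 by rewrite ler_piMr // ltW.
have i3 : mxip ((Q - 1%:M) *m refl v) ((Q - 1%:M) *m refl v) / (4 * (eps / 2)) <=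
    G * e1' / eps.
  rewrite ler_pdivrMr; last by rewrite mulr_gt0.
  by have -> : G * e1' / eps * (4 * (eps / 2)) = 2 * (G * e1') by field; rewrite gt_eqF.
have i4 : 8 * T / (4 * (eps / 2)) <= 4 * (G * e2') / eps.
  have -> : 8 * T / (4 * (eps / 2)) = 4 * T / eps by field; rewrite gt_eqF.
  by rewrite ler_pM2r ?invr_gt0 // ler_pM2l.
have e1'0 : 0 <= G * e1' by rewrite mulr_ge0 // subr_ge0 diag_orth_le.
have i5 : G * e1' / eps + 4 * (G * e2') / eps <=
    n.+1%:R ^+ 2 * G / eps * (e1' + 2 * e2').
  have -> : n.+1%:R ^+ 2 * G / eps * (e1' + 2 * e2') =
    n.+1%:R ^+ 2 * (G * e1' + 2 * (G * e2')) / eps by field; rewrite gt_eqF.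
  rewrite -mulrDl ler_pM2r ?invr_gt0 //.
  move: (G * e1') (G * e2') e1'0 (le_trans T0 Tle) n21 => x y x0 y0 n21; clear -x0 y0 n21.
  apply: le_trans (_ : 2 * (x + 2 * y) <= _); first by lra.
  by rewrite ler_wpM2r // addr_ge0 // mulr_ge0.
lra.
Qed.

End FaceGap.
End Gap.

(** * Dual bounds *)

Section TraceNorm.
Variables (R : realType) (n : nat).
Implicit Types (A X : 'M[R]_n).
Hypothesis has_svd : forall C : 'M[R]_n, exists U s V, is_svd C U s V.

Lemma trace_normE A : exists U s V, is_svd A U s V /\ trace_norm A = \sum_i s 0 i.
Proof.
have [U [s [V A_svd]]] := has_svd A.
have [U' [V' A_svd']] : [set s | exists U V, is_svd A U s V] (singular_values A).
  by apply: (@xgetPex _ 0); exists s, U, V.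
by exists U', (singular_values A), V'.
Qed.

Lemma mxip_le_trace_norm A X : orth X -> `|mxip A X| <= trace_norm A.
Proof.
have [U [s [V [[hU hV s0 _ AE] ->]]]] := trace_normE A => hX.
have -> : mxip A X = mxip (diag_mx s) (U^T *m X *m V).
  by rewrite AE mxip_mulr mxip_mull trmxK mulmxA.
by apply: diag_orth_abs_le => //; apply: orthM => //; apply: orthM => //; exact: orth_tr.
Qed.

Lemma mxip_self_le_trace_norm A : mxip A A <= trace_norm A ^+ 2.
Proof.
have [U [s [V [[hU hV s0 _ AE] ->]]]] := trace_normE A.
rewrite AE mxip_orthr ?mxip_orthl //; last exact: orth_tr.
rewrite mxip_diag expr2 mulr_suml ler_sum // => i _; rewrite mxE eqxx mulr1n.
by rewrite ler_wpM2l // (bigD1 i) //= lerDl sumr_ge0.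
Qed.

End TraceNorm.

Section Dual.
Variables (R : realType) (n : nat).
Implicit Types (A B X Y : 'M[R]_n.+1) (a b eps lam delta l u m : R).

Lemma mxip_penalty A B lam X : mxip (A - lam *: B) X = mxip A X - lam * mxip B X.
Proof. by rewrite mxipBl mxipZl. Qed.

(** With [B' = sg B] both sides of the constraint become an upper bound [b']. Weak duality, obtained
    by testing [X] against [Xo], bounds the dual value from below by the optimum; the assumed gap
    bounds it from above. *)
Lemma dual_output A B a b eps (sg b' lam : R) X Xo :
  let alpha := 1 / (1 + lam) in let beta := 0 - sg * lam / (1 + lam) in
  a <= b -> 0 <= lam -> 0 < eps ->
  (sg = 1 /\ b' = b \/ sg = -1 /\ b' = - a) ->
  face (A - lam *: (sg *: B)) X ->
  SO Xo -> mxip (sg *: B) Xo = b' ->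
  (forall Y, SO Y -> mxip (sg *: B) Y <= b' -> mxip A Y <= mxip A Xo) ->
  mxip A X - lam * (mxip (sg *: B) X - b') <= mxip A Xo + eps ->
  `|alpha| + `|beta| = 1 /\
  [/\ optimal A B a b Xo,
    `|mxip A X - lam * (mxip (sg *: B) X - b') - mxip A Xo| <= eps,
    `|sg * b' - mxip B Xo| <= eps
  & forall Y, SO Y -> mxip (alpha *: A + beta *: B) Y
                <= mxip (alpha *: A + beta *: B) Xo + eps].
Proof.
move=> alpha beta ab lam0 eps0 sgP [XSO Xmax] XoSO Xob Xopt gap.
have lam1 : 0 < 1 + lam by lra.
have sg2 : sg * sg = 1 by case: sgP => -[-> _]; rewrite ?mulr1 ?mulrNN ?mulr1.
have BE Y : mxip B Y = sg * mxip (sg *: B) Y by rewrite mxipZl mulrA sg2 mul1r.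
have lower := Xmax Xo XoSO; rewrite !mxip_penalty Xob in lower.
split.
  rewrite /alpha /beta sub0r normrN !normrM normfV (gtr0_norm lam1) normr1.
  have -> : `|sg| = 1 by case: sgP => -[-> _]; rewrite ?normrN normr1.
  by rewrite (ger0_norm lam0); field; rewrite gt_eqF.
have bnd Y : a <= mxip B Y <= b -> mxip (sg *: B) Y <= b'.
  by rewrite mxipZl; case: sgP => -[-> ->] /andP[h1 h2]; rewrite ?mul1r // mulN1r lerN2.
split.
- split.
    split=> //; rewrite BE Xob; case: sgP => -[-> ->].
      by rewrite mul1r ab lexx.
    by rewrite mulrNN mul1r lexx ab.
  by move=> Y [YSO Yab]; apply: Xopt => //; exact: bnd.
- by rewrite ger0_norm; lra.
- by rewrite BE Xob subrr normr0 ltW.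
move=> Y YSO; have := Xmax Y YSO.
rewrite !mxip_penalty !mxipDl !(mxipZl alpha) !(mxipZl beta) !BE Xob /alpha /beta => h.
have E x y : 1 / (1 + lam) * x + (0 - sg * lam / (1 + lam)) * (sg * y) =
    (x - sg * sg * lam * y) / (1 + lam) by field; rewrite gt_eqF.
rewrite !E sg2 !mul1r -lerBlDl -mulrBl ler_pdivrMr //.
have : eps <= eps * (1 + lam) by rewrite ler_peMr //; lra.
lra.
Qed.

Definition bracket A B b delta l u : Prop :=
  exists mu Y, [/\ l <= mu <= u, face (A - (mu / delta) *: B) Y & mxip B Y = b].

(** Adding the optimality conditions at two multipliers shows that [y] does not increase with the
    multiplier, so comparing one maximizer at [m] with [b] decides which half to keep. *)
Lemma bracket_step A B b delta l u m X : 0 < delta -> l <= m <= u ->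
  face (A - (m / delta) *: B) X -> bracket A B b delta l u ->
  if b <= mxip B X then bracket A B b delta m u else bracket A B b delta l m.
Proof.
move=> d0 /andP[lm mu] [XSO Xmax] [k [Y [/andP[lk ku] [YSO Ymax] Yb]]].
have h1 := Xmax Y YSO; have h2 := Ymax X XSO; rewrite !mxip_penalty Yb in h1 h2.
have mono : (m / delta - k / delta) * (mxip B X - b) <= 0 by lra.
rewrite -mulrBl mulrAC pmulr_lle0 ?invr_gt0 // in mono.
case: ifPn => [bX|]; last rewrite -ltNge => bX.
  (* If the known multiplier lies below [m], monotonicity forces [y = b] at [m] too, and [Y] is then
     also a maximizer at [m]. *)
  have [mk|km] := leP m k; first by exists k, Y; split=> //; rewrite mk.
  have Xb : mxip B X = b.
    by apply/eqP; rewrite eq_le bX andbT -subr_le0 -(pmulr_rle0 _ (_ : 0 < m - k)) ?subr_gt0.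
  exists m, Y; split=> //; first by rewrite lexx.
  split=> // Z ZSO; apply: le_trans (Xmax Z ZSO) _.
  by rewrite !mxip_penalty Yb Xb lerB //; rewrite Xb in h2; lra.
exists k, Y; split=> //; rewrite lk /= leNgt; apply/negP => mk.
by move: mono; rewrite nmulr_rle0 ?subr_lt0 // subr_ge0 leNgt bX.
Qed.

(* At the upper end [u] the maximizers lie below the level [b], by at most
   [delta], so the dual function has slope at most [1] in [mu = lam * delta]. *)
Lemma bracket_gap A B b delta l u eps X : 0 < delta ->
  bracket A B b delta l u -> u - l <= eps ->
  (forall Y, SO Y -> b - delta <= mxip B Y) ->
  face (A - (u / delta) *: B) X -> 0 <= l ->
  exists Xo, [/\ SO Xo, mxip B Xo = b,
    forall Y, SO Y -> mxip B Y <= b -> mxip A Y <= mxip A Xo &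
    mxip A X - u / delta * (mxip B X - b) <= mxip A Xo + eps].
Proof.
move=> d0 [k [Y [/andP[lk ku] [YSO Ymax] Yb]]] ul low [XSO _] l0.
exists Y; split=> //.
  move=> Z ZSO Zb; have := Ymax Z ZSO; rewrite !mxip_penalty Yb => h.
  have : k / delta * (mxip B Z - b) <= 0.
    by rewrite mulr_ge0_le0 ?subr_le0 // divr_ge0 ?(le_trans l0 lk) // ltW.
  lra.
have := Ymax X XSO; rewrite !mxip_penalty Yb => h.
have h2 : (u - k) / delta * (b - mxip B X) <= (u - k) / delta * delta.
  by rewrite ler_wpM2l ?divr_ge0 ?subr_ge0 ?(ltW d0) //; have := low X XSO; lra.
rewrite divfK ?gt_eqF // in h2; rewrite mulrBl in h2; lra.
Qed.

End Dual.

(** With [k] the integer part of the binary logarithm of [1 / eps], take [k + 2] halvings: one for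
    the truncation, one for the initial length [2]. As [eps <= 1 / 2], that logarithm is at least
    [1], whence the factor [3]. *)
Lemma halving_steps (R : realType) : exists c : R, forall eps : R,
  0 < eps -> eps <= 2^-1 ->
  exists2 K : nat, 2 / 2 ^+ K <= eps & K%:R <= c * ln (1 / eps).
Proof.
exists (3 / ln 2) => eps e0 e1.
have l2 : 0 < ln 2 :> R by rewrite ln_gt0 // ltr1n.
have L2 : ln 2 <= ln (1 / eps).
  by rewrite ler_ln ?posrE ?divr_gt0 // ler_pdivlMr //; lra.
have L0 : 0 <= ln (1 / eps) / ln 2 by rewrite divr_ge0 // ltW // (lt_le_trans l2).
have [k /andP[k1 k2]] : exists k : nat, k%:R <= ln (1 / eps) / ln 2 < k.+1%:R.
  by eexists; exact: truncn_itv L0.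
exists k.+2.
  have : 1 / eps <= 2 ^+ k.+1.
    rewrite -ler_ln ?posrE ?divr_gt0 ?exprn_gt0 // lnXn // -[leRHS]mulr_natl.
    by rewrite -ler_pdivrMr // ltW.
  by rewrite !ler_pdivrMr ?exprn_gt0 // [2 ^+ k.+2]exprS; lra.
have : 1 <= ln (1 / eps) / ln 2 by rewrite ler_pdivlMr // [leLHS]mul1r.
have -> : 3 / ln 2 * ln (1 / eps) = 3 * (ln (1 / eps) / ln 2) by rewrite mulrAC mulrA.
by rewrite -[k.+2]addn2 natrD; lra.
Qed.

(** * Program logic *)

Section ProgramLogic.
Variables (R : realType) (svd : svd_routine R).

Definition memory : Type := nat -> nat -> nat -> R.

Implicit Types (m : memory) (Q : memory -> Prop) (c d : cmd) (st : state R).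

Definition upd m x i j v : memory :=
  fun y k l => if [&& y == x, k == i & l == j] then v else m y k l.

(* A loop with counter [i] contains only loops with larger counters, hence the
   clause on the registers below [i]. *)
Definition run c i (T : nat) st Q : Prop := exists t st',
  [/\ exec svd c st t st', (t <= T)%N,
      forall r, (r < i)%N -> regs st' r = regs st r & Q (arrays st')].

Lemma run_weaken c i T T' st Q Q' : (T <= T')%N -> (forall m, Q m -> Q' m) ->
  run c i T st Q -> run c i T' st Q'.
Proof.
move=> TT QQ [t [st' [h1 h2 h3 h4]]]; exists t, st'; split=> //.
  exact: leq_trans TT.
exact: QQ.
Qed.

Lemma run_seq c d i T1 T2 st Q1 Q : run c i T1 st Q1 ->
  (forall st', (forall r, (r < i)%N -> regs st' r = regs st r) -> Q1 (arrays st') ->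
     run d i T2 st' Q) ->
  run (CSeq c d) i (T1 + T2) st Q.
Proof.
move=> [t [st' [h1 h2 h3 h4]]] /(_ st' h3 h4) [t' [st'' [k1 k2 k3 k4]]].
exists (t + t')%N, st''; split=> //; [exact: ExecSeq h1 k1|exact: leq_add|].
by move=> r ri; rewrite k3 // h3.
Qed.

Lemma run_set i T st x k l e Q : (ncost k + ncost l + rcost e < T)%N ->
  Q (upd (arrays st) x (nval st k) (nval st l) (rval st e)) ->
  run (CRSet x k l e) i T st Q.
Proof.
move=> hT hQ; exists (ncost k + ncost l + rcost e).+1,
  (set_cell st x (nval st k) (nval st l) (rval st e)).
by split=> //; exact: ExecRSet.
Qed.

Lemma run_if i T st b c d Q : run (if bval st b then c else d) i T st Q ->
  run (CIf b c d) i (T + (bcost b).+1) st Q.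
Proof.
move=> [t [st' [h1 h2 h3 h4]]]; exists (bcost b + t).+1, st'; split=> //.
  exact: ExecIf.
by rewrite addnS ltnS addnC leq_add2r.
Qed.

Lemma run_skip i T st Q : (0 < T)%N -> Q (arrays st) -> run CSkip i T st Q.
Proof. by move=> T0 hQ; exists 1%N, st; split=> //; exact: ExecSkip. Qed.

Definition CFor i body : cmd :=
  CSeq (CNSet i (NConst 0))
    (CWhile (BNot (BNLe (NReg 0) (NReg i)))
      (CSeq body (CNSet i (NAdd (NReg i) (NConst 1))))).

Lemma run_for i body T st (P : nat -> memory -> Prop) : (0 < i)%N ->
  P 0 (arrays st) ->
  (forall k st', (k < regs st 0)%N ->
     (forall r, (r < i)%N -> regs st' r = regs st r) -> regs st' i = k ->
     P k (arrays st') -> run body i.+1 T st' (P k.+1)) ->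
  run (CFor i body) i (regs st 0 * (T + 10) + 10) st (P (regs st 0)).
Proof.
move=> i0 P0 step; set N := regs st 0 in step *.
have loop j st' : (j <= N)%N ->
    (forall r, (r < i)%N -> regs st' r = regs st r) -> regs st' i = (N - j)%N ->
    P (N - j)%N (arrays st') ->
    run (CWhile (BNot (BNLe (NReg 0) (NReg i)))
      (CSeq body (CNSet i (NAdd (NReg i) (NConst 1))))) i (j * (T + 10) + 5) st' (P N).
  elim: j st' => [|j IH] st' jN hr hi hP.
    exists (4 + 1)%N, st'; split=> //; last by rewrite subn0 in hP.
    by apply: ExecWhileStop; rewrite /= hr // -/N hi subn0 leqnn.
  have lt : (N - j.+1 < N)%N by rewrite ltn_subrL /= (leq_trans _ jN).
  have [t [st1 [h1 h2 h3 h4]]] := step _ st' lt hr hi hP.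
  pose st2 := set_reg st1 i (regs st1 i + 1).
  have r2 r : (r < i)%N -> regs st2 r = regs st r.
    by move=> ri; rewrite /st2 /= ltn_eqF // h3 ?hr // ltnS ltnW.
  have i2 : regs st2 i = (N - j)%N.
    by rewrite /st2 /= eqxx h3 // hi addn1 -subSn // subSS.
  have [|t' [st3 [k1 k2 k3 k4]]] := IH st2 (ltnW jN) r2 i2.
    by rewrite -subSn // subSS in h4.
  exists (4 + (t + 4) + t').+1, st3; split=> //.
  - apply: ExecWhileStep k1; first by rewrite /= hr // -/N hi -ltnNge.
    by apply: ExecSeq h1 _; exact: (ExecNSet svd st1 i (NAdd (NReg i) (NConst 1))).
  - by rewrite mulSn; lia.
  - by move=> r ri; rewrite k3 // r2 // hr.
pose st1 := set_reg st i 0.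
have r1 r : (r < i)%N -> regs st1 r = regs st r by move=> ri; rewrite /st1 /= ltn_eqF.
have [||t [st' [h1 h2 h3 h4]]] := loop N st1 (leqnn _) r1.
- by rewrite subnn /= eqxx.
- by rewrite subnn.
exists (2 + t)%N, st'; split=> //.
- by apply: ExecSeq h1; exact: (ExecNSet svd st i (NConst 0)).
- by lia.
- by move=> r ri; rewrite h3 // r1.
Qed.

(** A positive loop bound lets the overhead be absorbed in the constant, so each level of nesting
    only raises the exponent. *)
Lemma run_forX i body (c k : nat) st (P : nat -> memory -> Prop) :
  (0 < i)%N -> (0 < regs st 0)%N ->
  P 0 (arrays st) ->
  (forall j st', (j < regs st 0)%N ->
     (forall r, (r < i)%N -> regs st' r = regs st r) -> regs st' i = j ->
     P j (arrays st') -> run body i.+1 (c * regs st 0 ^ k) st' (P j.+1)) ->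
  run (CFor i body) i ((c + 20) * regs st 0 ^ k.+1) st (P (regs st 0)).
Proof.
move=> i0 N0 P0 step; apply: run_weaken (run_for i0 P0 step) => //.
rewrite expnS; set N := regs st 0 in N0 *.
have : (0 < N ^ k)%N by rewrite expn_gt0 N0.
by move: (N ^ k)%N => z z0; nia.
Qed.

(* The expression [e] refers to the row and column indices as registers 1 and 2. *)
Definition fill x e : cmd := CFor 1 (CFor 2 (CRSet x (NReg 1) (NReg 2) e)).

Lemma run_fill x e (c : nat) st (E : nat -> nat -> R) : (0 < regs st 0)%N ->
  (rcost e + 2 < c)%N ->
  (forall st', regs st' 0 = regs st 0 ->
     (forall y k l, y != x -> arrays st' y k l = arrays st y k l) ->
     rval st' e = E (regs st' 1%N) (regs st' 2%N)) ->
  run (fill x e) 1 ((c + 40) * regs st 0 ^ 2) st (fun m' => forall y k l,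
    m' y k l = if [&& y == x, (k < regs st 0)%N & (l < regs st 0)%N] then E k l
               else arrays st y k l).
Proof.
move=> N0 ec eE; set N := regs st 0 in N0 eE *.
pose P k0 (m' : memory) := forall y k l,
  m' y k l = if [&& y == x, (k < k0)%N & (l < N)%N] then E k l else arrays st y k l.
rewrite (_ : c + 40 = c + 20 + 20)%N; last by rewrite -addnA.
apply: (@run_forX 1 _ (c + 20)%N 1 st P) => //.
  by move=> y k l; rewrite ltn0 andbF.
move=> k0 st1 kN r1 i1 P1; have N1 : regs st1 0 = N by rewrite r1.
pose P' l0 (m' : memory) := forall y k l,
  m' y k l = if [&& y == x, (k < k0)%N || (k == k0) && (l < l0)%N & (l < N)%N]
             then E k l else arrays st y k l.
rewrite -/N -N1; apply: run_weaken (@run_forX 2 _ c 0 st1 P' _ _ _ _) => //.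
- move=> m' h y k l; rewrite h N1 [(k < k0.+1)%N]ltnS [(k <= k0)%N]leq_eqVlt.
  by case: (l < N)%N; case: (k == k0); case: (k < k0)%N; case: (y == x).
- by rewrite N1.
- by move=> y k l; rewrite P1 ltn0 andbF orbF.
move=> l0 st2; rewrite N1 => lN r2 i2 P2; apply: run_set.
  by rewrite /= expn0 muln1; move: ec; rewrite addnC.
move=> y k l; rewrite /upd /= i2 r2 // i1.
have -> : rval st2 e = E k0 l0.
  rewrite eE ?i2 ?r2 ?i1 // => y' k' l' /negPf yx.
  by rewrite P2 yx.
rewrite P2; case: (y == x) => //=.
have [->|kk] := eqVneq k k0; last by rewrite /= !orbF.
rewrite ltnn /= [(l < l0.+1)%N]ltnS [(l <= l0)%N]leq_eqVlt.
by have [->|ll] := eqVneq l l0; rewrite //= lN.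
Qed.

Definition agree (xs : seq nat) m m' : Prop :=
  forall y k l, y \notin xs -> m' y k l = m y k l.

Lemma run_svd (x u s v i n : nat) st : svd_correct svd -> regs st 0 = n ->
  uniq [:: u; s; v] ->
  run (CSvd (NReg 0) x u s v) i (3 * n ^ 3 + 3) st (fun m' =>
    agree [:: u; s; v] (arrays st) m' /\
    exists U w V, [/\ is_svd (get_mx st n n x) U w V,
      forall i j : 'I_n, m' u i j = U i j, forall i : 'I_n, m' s 0%N i = w 0 i &
      forall i j : 'I_n, m' v i j = V i j]).
Proof.
move=> svdP nE; rewrite /= !inE negb_or andbT => /andP[/andP[us uv] sv].
exists (1 + n ^ 3).+1, (do_svd svd st n x u s v); split=> //.
- by have := ExecSvd svd (NReg 0) x u s v st; rewrite /= nE.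
- by lia.
- by rewrite /do_svd; case: (svd _) => -[].
have := svdP _ (get_mx st n n x); rewrite /do_svd; case: (svd _) => -[U w] V UwV.
have putE p q (M : 'M[R]_(p, q)) st' z (k : 'I_p) (l : 'I_q) :
    arrays (put_mx st' z M) z k l = M k l by rewrite /= eqxx !valK.
have put_other p q (M : 'M[R]_(p, q)) st' z y k l : y != z ->
    arrays (put_mx st' z M) y k l = arrays st' y k l by move=> /negPf /= ->.
split; first by move=> y k l; rewrite !inE !negb_or => /and3P[yu ys yv]; rewrite !put_other.
exists U, w, V; split=> //.
- by move=> k l; rewrite put_other // put_other // putE.
- by move=> k; rewrite put_other //; exact: (putE 1%N n w _ _ ord0).
Qed.

(** Two cells are summed at once because the coordinates along [A] and [B'] come from the same
    triple loop; [gap_loop] takes zero for the second. *)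
Lemma run_accum i body (c e : nat) st x j1 j2 (F G : nat -> R) :
  j1 != j2 -> (0 < i)%N -> (0 < regs st 0)%N ->
  (forall j st', (j < regs st 0)%N ->
     (forall r, (r < i)%N -> regs st' r = regs st r) -> regs st' i = j ->
     (forall y k l, ~~ [&& y == x, k == 0%N & (l == j1) || (l == j2)] ->
        arrays st' y k l = arrays st y k l) ->
     run body i.+1 (c * regs st 0 ^ e) st' (fun m' =>
       [/\ forall y k l, ~~ [&& y == x, k == 0%N & (l == j1) || (l == j2)] ->
              m' y k l = arrays st y k l,
            m' x 0%N j1 = arrays st' x 0%N j1 + F j &
            m' x 0%N j2 = arrays st' x 0%N j2 + G j])) ->
  run (CFor i body) i ((c + 20) * regs st 0 ^ e.+1) st (fun m' =>
    [/\ forall y k l, ~~ [&& y == x, k == 0%N & (l == j1) || (l == j2)] ->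
           m' y k l = arrays st y k l,
         m' x 0%N j1 = arrays st x 0%N j1 + \sum_(j < regs st 0) F j &
         m' x 0%N j2 = arrays st x 0%N j2 + \sum_(j < regs st 0) G j]).
Proof.
move=> j12 i0 N0 step.
apply: (@run_forX i body c e st (fun j m' =>
    [/\ forall y k l, ~~ [&& y == x, k == 0%N & (l == j1) || (l == j2)] ->
           m' y k l = arrays st y k l,
         m' x 0%N j1 = arrays st x 0%N j1 + \sum_(j0 < j) F j0 &
         m' x 0%N j2 = arrays st x 0%N j2 + \sum_(j0 < j) G j0])) => //.
  by rewrite !big_ord0 !addr0.
move=> j st' jN hr hi [h1 h2 h3].
apply: run_weaken (step j st' jN hr hi h1) => // m' [k1 k2 k3]; split=> //.
  by rewrite k2 h2 big_ord_recr /= addrA.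
by rewrite k3 h3 big_ord_recr /= addrA.
Qed.

End ProgramLogic.

(** * The program *)

Definition nat_const k : rexp := RNat (NConst k).

(* Array 14 holds the scalar variables: the coefficients 0 and 1 of [A] and [B']
   in the queried direction, the coordinates 2 and 3 of the maximizer found, the
   determinant 4, the sign 5 with [B' = sg B], the level 6 of [B'], the ends 7 and
   8 of the bracket, its scale 9, the multiplier 10 and the midpoint 11. *)
Definition var j : rexp := RGet 14 (NConst 0) (NConst j).
Definition assign j e : cmd := CRSet 14 (NConst 0) (NConst j) e.

Definition load_direction : cmd :=
  fill 4 (RAdd (RMul (var 0) (RGet 0 (NReg 1) (NReg 2)))
               (RMul (var 1) (RGet 12 (NReg 1) (NReg 2)))).

(** Array 13 is to become the diagonal [(1, ..., 1, d)]; its last entry is overwritten once [d] is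
    known. *)
Definition sign_loop : cmd :=
  CFor 1 (CSeq (CRSet 13 (NConst 0) (NReg 1) (nat_const 1))
    (CIf (BRLe (RGet 10 (NConst 0) (NReg 1)) (nat_const 0))
      (assign 4 (RSub (nat_const 0) (var 4))) CSkip)).

Definition coord_term x : rexp :=
  RMul (RMul (RMul (RGet 5 (NReg 2) (NReg 1)) (RGet 13 (NConst 0) (NReg 1)))
    (RGet 7 (NReg 3) (NReg 1))) (RGet x (NReg 2) (NReg 3)).

(** Both inner products are expanded over all index triples, so the maximizer itself is never formed
    and the cost stays cubic. *)
Definition coord_loop : cmd :=
  CFor 1 (CFor 2 (CFor 3
    (CSeq (assign 2 (RAdd (var 2) (coord_term 0)))
          (assign 3 (RAdd (var 3) (coord_term 12)))))).

Definition last_index : nexp := NSub (NReg 0) (NConst 1).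

(* The sign of [det U * det V] is obtained without computing a determinant, from
   the number of zero singular values of [U + V] (see [svd_parity]). *)
Definition oracle : cmd :=
  CSeq load_direction
  (CSeq (CSvd (NReg 0) 4 5 6 7)
  (CSeq (fill 8 (RAdd (RGet 5 (NReg 1) (NReg 2)) (RGet 7 (NReg 1) (NReg 2))))
  (CSeq (CSvd (NReg 0) 8 9 10 11)
  (CSeq (assign 4 (nat_const 1))
  (CSeq sign_loop
  (CSeq (CRSet 13 (NConst 0) last_index (var 4))
  (CSeq (assign 2 (nat_const 0))
  (CSeq (assign 3 (nat_const 0))
  coord_loop)))))))).

(** * Correctness and cost of one oracle call *)

Section Oracle.
Variables (R : realType) (svd : svd_routine R).
Hypothesis svdP : svd_correct svd.
Variable n : nat.
Implicit Types (A B C U V X : 'M[R]_n.+1) (m : memory R) (st : state R).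

Definition holds m x (M : 'M[R]_n.+1) := forall i j : 'I_n.+1, m x i j = M i j.

Lemma run_sign_loop st (s : 'rV[R]_n.+1) : regs st 0 = n.+1 ->
  (forall i : 'I_n.+1, arrays st 10 0%N i = s 0 i) -> arrays st 14 0%N 4 = 1 ->
  run svd sign_loop 1 (70 * n.+1 ^ 3) st (fun m' =>
    [/\ forall y k l, y != 13 -> ~~ [&& y == 14, k == 0%N & l == 4] ->
          m' y k l = arrays st y k l,
        forall i : 'I_n.+1, m' 13 0%N i = 1 &
        m' 14 0%N 4 = \prod_i (if s 0 i <= 0 then -1 else 1)]).
Proof.
move=> N0 sE d1; pose F j : R := if arrays st 10 0%N j <= 0 then -1 else 1.
pose P j (m' : memory R) :=
    [/\ forall y k l, y != 13 -> ~~ [&& y == 14, k == 0%N & l == 4] ->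
          m' y k l = arrays st y k l,
        forall l, (l < j)%N -> m' 13 0%N l = 1 &
        m' 14 0%N 4 = \prod_(i < j) F i].
have h : run svd sign_loop 1 ((50 + 20) * regs st 0 ^ 1) st (P (regs st 0)).
  apply: run_forX => //; first by rewrite N0.
    by rewrite /P big_ord0.
  move=> j st1 jN hr hi [h1 h2 h3]; rewrite expn0 muln1.
  apply: (@run_weaken _ _ _ _ (20 + (20 + 10)) _ _ (P j.+1)) => //.
  apply: (@run_seq _ _ _ _ _ 20 (20 + 10) _ (fun m' => m' = upd (arrays st1) 13 0%N j 1)).
    by apply: run_set => //=; rewrite hi.
  move=> st2 hr2 m2; apply: (@run_weaken _ _ _ _ (20 + 7) _ _ (P j.+1)) => //.
  apply: run_if.
  have i2 : regs st2 1%N = j by rewrite hr2.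
  have FE : bval st2 (BRLe (RGet 10 (NConst 0) (NReg 1)) (nat_const 0)) =
      (arrays st 10 0%N j <= 0) by rewrite /= i2 m2 /upd /= h1.
  have P2 l : (l < j.+1)%N -> arrays st2 13 0%N l = 1.
    by rewrite ltnS leq_eqVlt m2 /upd /= => /orP[/eqP ->|lj]; rewrite ?eqxx //;
      case: eqP => // _; exact: h2.
  have P1 y k l : y != 13 -> ~~ [&& y == 14, k == 0%N & l == 4] ->
      arrays st2 y k l = arrays st y k l.
    by move=> yx hn; rewrite m2 /upd (negPf yx) /= h1.
  have P3 : arrays st2 14 0%N 4 = \prod_(i < j) F i by rewrite m2 /upd /= h3.
  rewrite FE; case: ifPn => sj.
    have Fj : F j = -1 by rewrite /F sj.
    apply: run_set => //; rewrite /= sub0r; split.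
    - by move=> y k l yx hn; rewrite /upd (negPf hn) P1.
    - by move=> l lj; rewrite /upd /= P2.
    - by rewrite /upd !eqxx /= P3 big_ord_recr /= Fj mulrN1.
  apply: run_skip => //; split=> //.
  have Fj : F j = 1 by rewrite /F (negPf sj).
  by rewrite P3 big_ord_recr /= Fj mulr1.
apply: run_weaken h => [|m'].
  by rewrite N0 leq_mul2l /= leq_pexp2l.
rewrite N0 => -[h1 h2 h3]; split=> //; first by move=> i; rewrite h2.
by rewrite h3; apply: eq_bigr => i _; rewrite /F sE.
Qed.

Lemma run_coord_loop st A B U V (g : 'rV[R]_n.+1) : regs st 0 = n.+1 ->
  holds (arrays st) 0 A -> holds (arrays st) 12 B ->
  holds (arrays st) 5 U -> holds (arrays st) 7 V ->
  (forall i : 'I_n.+1, arrays st 13 0%N i = g 0 i) ->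
  arrays st 14 0%N 2 = 0 -> arrays st 14 0%N 3 = 0 ->
  run svd coord_loop 1 (160 * n.+1 ^ 3) st (fun m' =>
    [/\ forall y k l, ~~ [&& y == 14, k == 0%N & (l == 2) || (l == 3)] ->
          m' y k l = arrays st y k l,
        m' 14 0%N 2 = mxip A (U *m diag_mx g *m V^T) &
        m' 14 0%N 3 = mxip B (U *m diag_mx g *m V^T)]).
Proof.
move=> N0 hA hB hU hV hg x0 y0.
pose T z i k l := arrays st 5 k i * arrays st 13 0%N i * arrays st 7 l i *
  arrays st z k l.
have tot z (Z : 'M[R]_n.+1) : holds (arrays st) z Z ->
    \sum_(i < n.+1) \sum_(k < n.+1) \sum_(l < n.+1) T z i k l =
    mxip Z (U *m diag_mx g *m V^T).
  move=> hZ; rewrite mxipE exchange_big; apply: eq_bigr => k _.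
  rewrite exchange_big; apply: eq_bigr => l _; rewrite mxE mulr_sumr.
  apply: eq_bigr => i _; rewrite /T hU hV hZ hg mul_mx_diag !mxE.
  by ring.
pose off m := forall y k l, ~~ [&& y == 14, k == 0%N & (l == 2) || (l == 3)] ->
          m y k l = arrays st y k l.
have h : run svd coord_loop 1 ((((100 + 20) + 20) + 20) * regs st 0 ^ 3) st (fun m' =>
    [/\ off m',
        m' 14 0%N 2 = arrays st 14 0%N 2 +
          \sum_(i < regs st 0) \sum_(k < regs st 0) \sum_(l < regs st 0) T 0%N i k l &
        m' 14 0%N 3 = arrays st 14 0%N 3 +
          \sum_(i < regs st 0) \sum_(k < regs st 0) \sum_(l < regs st 0) T 12 i k l]).
  apply: (@run_accum _ _ 1 _ _ 2 _ 14 2 3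
    (fun i => \sum_(k < regs st 0) \sum_(l < regs st 0) T 0%N i k l)
    (fun i => \sum_(k < regs st 0) \sum_(l < regs st 0) T 12 i k l)) => //.
    by rewrite N0.
  move=> i st1 iN r1 i1 off1; have N1 : regs st1 0 = regs st 0 by rewrite r1.
  rewrite -N1; apply: run_weaken (@run_accum _ _ 2 _ _ 1 _ 14 2 3
    (fun k => \sum_(l < regs st 0) T 0%N i k l)
    (fun k => \sum_(l < regs st 0) T 12 i k l) _ _ _ _) => //.
  - move=> m' [k1 k2 k3]; split; [|by rewrite k2 N1|by rewrite k3 N1].
    by move=> y k l hn; rewrite k1 // off1.
  - by rewrite N1 N0.
  move=> k st2; rewrite N1 => kN r2 i2 off2.
  have N2 : regs st2 0 = regs st 0 by rewrite r2.
  rewrite -N2; apply: run_weaken (@run_accum _ _ 3 _ _ 0 _ 14 2 3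
    (fun l => T 0%N i k l) (fun l => T 12 i k l) _ _ _ _) => //.
  - move=> m' [k1 k2 k3]; split; [|by rewrite k2 N2|by rewrite k3 N2].
    by move=> y k' l hn; rewrite k1 // off2.
  - by rewrite N2 N0.
  move=> l st3; rewrite N2 => lN r3 i3 off3.
  have e1 : regs st3 1%N = i by rewrite r3 // r2 // i1.
  have e2 : regs st3 2%N = k by rewrite r3 // i2.
  have off0 y k' l' : ~~ [&& y == 14, k' == 0%N & (l' == 2) || (l' == 3)] ->
      arrays st3 y k' l' = arrays st y k' l'.
    by move=> hn; rewrite off3 // off2 // off1.
  rewrite expn0 muln1; apply: (@run_weaken _ _ _ _ (40 + 40) _ _ _ _ _ (fun m h => h)) => //.
  apply: (@run_seq _ _ _ _ _ 40 40 _
      (fun m' => m' = upd (arrays st3) 14 0%N 2 (arrays st3 14 0%N 2 + T 0%N i k l))).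
    by apply: run_set => //=; rewrite e1 e2 i3 (off0 5) // (off0 13) // (off0 7) // (off0 0%N).
  move=> st4 r4 m4; apply: run_set => //; rewrite /= !r4 // e1 e2 i3 m4 /upd /=.
  rewrite (off0 5) // (off0 13) // (off0 7) // (off0 12) //.
  split=> // y k' l' hn; rewrite -off0 // -[RHS]off3 //.
  move: hn; case: (y == 14) => //=; case: (k' == 0%N) => //=.
  by rewrite negb_or => /andP[/negPf -> /negPf ->].
apply: run_weaken h => [|m']; first by rewrite N0.
by rewrite N0 x0 y0 !add0r => -[h1 -> ->]; split=> //; exact: tot.
Qed.

(** What survives a call: the input and output arrays, [B'] in array 12, and the scalars other than
    the results 2 and 3 and the determinant 4. *)
Definition oracle_frame m m' := forall y k l,
  [|| (y < 4)%N, y == 12 | (y == 14) && (k == 0%N) && ((l < 2) || (4 < l))%N] ->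
  m' y k l = m y k l.

Lemma oracleP st A B (p q : R) : regs st 0 = n.+1 ->
  holds (arrays st) 0 A -> holds (arrays st) 12 B ->
  arrays st 14 0%N 0%N = p -> arrays st 14 0%N 1%N = q ->
  run svd oracle 1 (600 * n.+1 ^ 3) st (fun m' =>
    oracle_frame (arrays st) m' /\
    exists U s V X, [/\ is_svd (p *: A + q *: B) U s V, face (p *: A + q *: B) X,
      forall i : 'I_n.+1, m' 6 0%N i = s 0 i,
      m' 14 0%N 2 = mxip A X & m' 14 0%N 3 = mxip B X]).
Proof.
move=> N0 hA hB hp hq; set C := p *: A + q *: B.
have c1 : (0 < n.+1 ^ 3)%N by rewrite expn_gt0.
have e23 : (n.+1 ^ 2 <= n.+1 ^ 3)%N by rewrite leq_pexp2l.
apply: (@run_weaken _ _ _ _ (80 * n.+1 ^ 3 + ((3 * n.+1 ^ 3 + 3) + (80 * n.+1 ^ 3 +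
  ((3 * n.+1 ^ 3 + 3) + (20 + (70 * n.+1 ^ 3 + (20 + (20 + (20 + 160 * n.+1 ^ 3))))))))) _ _ _ _ _
  (fun m h => h)); first by move: (n.+1 ^ 3)%N c1 => z; lia.
pose E k l := p * arrays st 0 k l + q * arrays st 12 k l.
apply: run_seq.
  apply: run_weaken (run_fill svd (c := 40) (E := E) _ _ _).
  - by rewrite N0; move: (n.+1 ^ 2)%N (n.+1 ^ 3)%N e23; lia.
  - by move=> m' h; exact: h.
  - by rewrite N0.
  - by [].
  by move=> st' r0 hst' /=; rewrite !hst' // hp hq.
move=> st1 r1 h1; have N1 : regs st1 0 = n.+1 by rewrite r1.
have C1 : get_mx st1 n.+1 n.+1 4 = C.
  by apply/matrixP => i j; rewrite !mxE h1 N0 !ltn_ord /= /E hA hB.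
have k1 y k l : y != 4 -> arrays st1 y k l = arrays st y k l.
  by move=> /negPf yn; rewrite h1 yn.
apply: run_seq; first exact: (run_svd 4 1 svdP N1 (u := 5) (s := 6) (v := 7)).
move=> st2 r2 [k2 [U [s [V [CE hU hs hV]]]]]; rewrite C1 in CE.
have N2 : regs st2 0 = n.+1 by rewrite r2.
pose E2 k l := arrays st2 5 k l + arrays st2 7 k l.
apply: run_seq.
  apply: run_weaken (run_fill svd (c := 40) (E := E2) _ _ _).
  - by rewrite N2; move: (n.+1 ^ 2)%N (n.+1 ^ 3)%N e23; lia.
  - by move=> m' h; exact: h.
  - by rewrite N2.
  - by [].
  by move=> st' r0 hst' /=; rewrite !hst'.
move=> st3 r3 h3; have N3 : regs st3 0 = n.+1 by rewrite r3.
have C3 : get_mx st3 n.+1 n.+1 8 = U + V.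
  by apply/matrixP => i j; rewrite !mxE h3 N2 !ltn_ord /= /E2 hU hV.
have k3 y k l : y != 8 -> arrays st3 y k l = arrays st2 y k l.
  by move=> /negPf yn; rewrite h3 yn.
apply: run_seq; first exact: (run_svd 8 1 svdP N3 (u := 9) (s := 10) (v := 11)).
move=> st4 r4 [k4 [U' [s' [V' [UVE _ hs' _]]]]]; rewrite C3 in UVE.
have N4 : regs st4 0 = n.+1 by rewrite r4.
apply: (@run_seq _ _ _ _ _ _ _ _ (fun m' => m' = upd (arrays st4) 14 0%N 4 1)).
  exact: run_set.
move=> st5 r5 m5; have N5 : regs st5 0 = n.+1 by rewrite r5.
apply: run_seq; first apply: (@run_sign_loop st5 s' N5).
- by move=> i; rewrite m5 /upd /= hs'.
- by rewrite m5.
have [hUo hVo _ _ _] := CE.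
rewrite -(svd_parity hUo hVo UVE); set d := \det U * \det V.
move=> st6 r6 [k6 h6 d6]; have N6 : regs st6 0 = n.+1 by rewrite r6.
apply: (@run_seq _ _ _ _ _ _ _ _ (fun m' => m' = upd (arrays st6) 13 0%N n d)).
  by apply: run_set => //=; rewrite N6 subn1 d6.
move=> st7 r7 m7; have N7 : regs st7 0 = n.+1 by rewrite r7.
apply: (@run_seq _ _ _ _ _ _ _ _ (fun m' => m' = upd (arrays st7) 14 0%N 2 0)).
  exact: run_set.
move=> st8 r8 m8; have N8 : regs st8 0 = n.+1 by rewrite r8.
apply: (@run_seq _ _ _ _ _ _ _ _ (fun m' => m' = upd (arrays st8) 14 0%N 3 0)).
  exact: run_set.
move=> st9 r9 m9; have N9 : regs st9 0 = n.+1 by rewrite r9.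
have k59 y k l : y != 13 -> y != 14 -> arrays st9 y k l = arrays st4 y k l.
  move=> y13 y14; rewrite m9 m8 m7 /upd (negPf y13) (negPf y14) /= k6 //.
    by rewrite m5 /upd (negPf y14).
  by rewrite (negPf y14).
have k5' y k l : y \notin [:: 4; 5; 6; 7; 8; 9; 10; 11; 13; 14] ->
    arrays st9 y k l = arrays st y k l.
  move=> hy; have yz z : z \in [:: 4; 5; 6; 7; 8; 9; 10; 11; 13; 14] -> y != z.
    by move=> zs; apply: contraNneq hy => ->.
  by rewrite k59 ?yz // k4 ?k3 ?k2 ?k1 ?yz // !inE !negb_or !yz.
pose g : 'rV[R]_n.+1 := \row_i (if i == ord_max then d else 1).
have g9 (i : 'I_n.+1) : arrays st9 13 0%N i = g 0 i.
  by rewrite m9 m8 m7 /upd /= !mxE -val_eqE /=; case: ifP.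
apply: run_weaken (@run_coord_loop st9 A B U V g N9 _ _ _ _ g9 _ _) => //.
- move=> m' [k10 x10 y10]; split.
    move=> y k l hy; rewrite k10; last first.
      by case/or3P: hy => [|/eqP -> //|]; [case: y => [|[|[|[|?]]]]
        |case: (y == 14) => //=; case: (k == 0%N) => //=; case: l => [|[|[|[|?]]]]].
    have [yE|y14] := eqVneq y 14.
      move: hy; rewrite yE /= => /andP[/eqP -> hl].
      rewrite m9 m8 m7 /upd /= k6 // ?m5 /upd /=; last by case: l hl => [|[|[|[|[|?]]]]].
      by case: l hl => [|[|[|[|[|?]]]]] //= _; rewrite k4 // k3 // k2 // k1.
    apply: k5'; rewrite (negPf y14) /= orbF in hy.
    by case/orP: hy => [|/eqP -> //]; case: y y14 => [|[|[|[|?]]]].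
  exists U, s, V, (U *m diag_mx g *m V^T); split=> //.
    exact: svd_face CE.
  by move=> i; rewrite k10 // k59 // k4 // k3 // hs.
- by move=> i j; rewrite k5' ?hA.
- by move=> i j; rewrite k5' ?hB.
- by move=> i j; rewrite k59 // k4 // k3 // hU.
- by move=> i j; rewrite k59 // k4 // k3 // hV.
- by rewrite m9 m8 /upd /=.
- by rewrite m9 /upd /=.
Qed.

End Oracle.

Definition lower_bound : rexp := RGet 2 (NConst 0) (NConst 0).
Definition upper_bound : rexp := RGet 2 (NConst 0) (NConst 1).
Definition precision : rexp := RGet 2 (NConst 0) (NConst 2).
Definition return_value k e : cmd := CRSet 3 (NConst 0) (NConst k) e.

Definition load_signed : cmd := fill 12 (RMul (var 5) (RGet 1 (NReg 1) (NReg 2))).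

Definition penalized_oracle : cmd :=
  CSeq (assign 0 (nat_const 1)) (CSeq (assign 1 (RSub (nat_const 0) (var 10))) oracle).

(** The number of rounds is never computed by the program; it enters only the analysis, and the loop
    stops on a comparison of reals. *)
Definition bisection : cmd :=
  CWhile (BNot (BRLe (RSub (var 8) (var 7)) precision))
    (CSeq (assign 11 (RDiv (RAdd (var 7) (var 8)) (nat_const 2)))
    (CSeq (assign 10 (RDiv (var 11) (var 9)))
    (CSeq penalized_oracle
    (CIf (BRLe (var 6) (var 3)) (assign 7 (var 11)) (assign 8 (var 11)))))).

Definition singular_value i : rexp := RGet 6 (NConst 0) i.

Definition gap_loop : cmd :=
  CFor 1 (assign 2 (RAdd (var 2) (RAdd (RDiv (nat_const 1) (singular_value (NReg 1)))
    (RDiv (nat_const 1) (RSub (singular_value (NReg 1)) (singular_value last_index)))))).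

(* When the level [b'] is the minimum of [B'] over SO(n), no dual optimum need
   exist, and the multiplier comes from the spectral gap ([face_gap]). *)
Definition choose_multiplier : cmd :=
  CIf (BRLe (var 9) (nat_const 0))
    (CSeq (assign 2 (nat_const 0))
    (CSeq gap_loop
      (assign 10 (RDiv (RMul (RMul (RNat (NReg 0)) (RNat (NReg 0))) (var 2)) precision))))
    (CSeq (assign 7 (nat_const 0))
    (CSeq (assign 8 (nat_const 2))
    (CSeq bisection
      (assign 10 (RDiv (var 8) (var 9)))))).

(** The query in direction [- B'] yields the minimum of [B'], hence the scale 9, and leaves in array
    6 the singular values from which [gap_loop] reads the spectral gap. *)
Definition active_case : cmd :=
  CSeq load_signed
  (CSeq (assign 0 (nat_const 0))
  (CSeq (assign 1 (RSub (nat_const 0) (nat_const 1)))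
  (CSeq oracle
  (CSeq (assign 9 (RSub (var 6) (var 3)))
  (CSeq choose_multiplier
  (CSeq penalized_oracle
  (CSeq (return_value 0 (RSub (var 2) (RMul (var 10) (RSub (var 3) (var 6)))))
  (CSeq (return_value 1 (RMul (var 5) (var 6)))
  (CSeq (return_value 2 (RDiv (nat_const 1) (RAdd (nat_const 1) (var 10))))
    (return_value 3 (RSub (nat_const 0) (RDiv (RMul (var 5) (var 10)) (RAdd (nat_const 1) (var 10)))))))))))))).

Definition inactive_case : cmd :=
  CSeq (return_value 0 (var 2))
  (CSeq (return_value 1 (var 3))
  (CSeq (return_value 2 (nat_const 1))
    (return_value 3 (nat_const 0)))).

Definition program : cmd :=
  CSeq (assign 5 (nat_const 1))
  (CSeq load_signed
  (CSeq (assign 0 (nat_const 1))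
  (CSeq (assign 1 (nat_const 0))
  (CSeq oracle
  (CIf (BRLe lower_bound (var 3))
    (CIf (BRLe (var 3) upper_bound)
      inactive_case
      (CSeq (assign 6 upper_bound) active_case))
    (CSeq (assign 5 (RSub (nat_const 0) (nat_const 1)))
    (CSeq (assign 6 (RSub (nat_const 0) lower_bound)) active_case))))))).

(** * Correctness and cost of the whole program *)

Section Correctness.
Variables (R : realType) (svd : svd_routine R).
Hypothesis svdP : svd_correct svd.
Variables (n : nat) (A B : 'M[R]_n.+1) (eps : R).
Hypotheses (n2 : (1 < n)%N) (trA : trace_norm A = 1) (trB : trace_norm B = 1).
Hypotheses (eps0 : 0 < eps) (eps1 : eps <= 2^-1).
Implicit Types (m : memory R) (st : state R) (X : 'M[R]_n.+1).

Lemma svd_exists k (C : 'M[R]_k) : exists U s V, is_svd C U s V.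
Proof. by have := svdP C; case: (svd C) => -[U s] V h; exists U, s, V. Qed.

Lemma A_le1 X : orth X -> `|mxip A X| <= 1.
Proof. by rewrite -trA; apply: mxip_le_trace_norm; exact: svd_exists. Qed.

Lemma B_le1 X : orth X -> `|mxip B X| <= 1.
Proof. by rewrite -trB; apply: mxip_le_trace_norm; exact: svd_exists. Qed.

Lemma AA_le1 : mxip A A <= 1.
Proof.
by rewrite -[leRHS](expr1n _ 2) -trA; apply: mxip_self_le_trace_norm; exact: svd_exists.
Qed.

Definition correct_output (a b : R) m : Prop :=
  let alpha := m 3 0%N 2 in let beta := m 3 0%N 3 in
  `|alpha| + `|beta| = 1 /\
  exists Xopt, [/\ optimal A B a b Xopt,
    `|m 3 0%N 0%N - mxip A Xopt| <= eps,
    `|m 3 0%N 1%N - mxip B Xopt| <= eps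
  & forall X, SO X -> mxip (alpha *: A + beta *: B) X
                <= mxip (alpha *: A + beta *: B) Xopt + eps].

Section Signed.
Variables (sg b' : R).
Hypothesis sg1 : sg = 1 \/ sg = -1.

Local Notation B' := (sg *: B).

Definition loaded m : Prop :=
  [/\ holds m 0 A, m 2 0%N 2 = eps, holds m 12 B', m 14 0%N 5 = sg & m 14 0%N 6 = b'].

Lemma loaded_upd m j v : j != 5 -> j != 6 -> loaded m -> loaded (upd m 14 0%N j v).
Proof.
by move=> j5 j6 [h0 h1 h2 h3 h4]; split=> //; rewrite /upd /= eq_sym ?(negPf j5) ?(negPf j6).
Qed.

Lemma loaded_frame m m' : oracle_frame m m' -> loaded m -> loaded m'.
Proof.
move=> fr [h0 h1 h2 h3 h4]; split; try by rewrite fr.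
  by move=> i j; rewrite fr // h0.
by move=> i j; rewrite fr // h2.
Qed.

Lemma signed_le1 X : orth X -> `|mxip B' X| <= 1.
Proof.
by move=> /B_le1; rewrite mxipZl normrM; case: sg1 => ->; rewrite ?normrN normr1 mul1r.
Qed.

Lemma run_penalized_oracle st lam : regs st 0 = n.+1 -> loaded (arrays st) ->
  arrays st 14 0%N 10 = lam ->
  run svd penalized_oracle 1 (620 * n.+1 ^ 3) st (fun m' =>
    [/\ loaded m', forall l, (4 < l)%N -> m' 14 0%N l = arrays st 14 0%N l &
    exists X, [/\ face (A - lam *: B') X, m' 14 0%N 2 = mxip A X &
      m' 14 0%N 3 = mxip B' X]]).
Proof.
move=> N0 hl hlam; have z0 : (0 < n.+1 ^ 3)%N by rewrite expn_gt0.
apply: (@run_weaken _ _ _ _ (10 + (10 + 600 * n.+1 ^ 3)) _ _ _ _ _ (fun m h => h)).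
  by move: (n.+1 ^ 3)%N z0 => z; lia.
apply: (@run_seq _ _ _ _ _ _ _ _ (fun m' => m' = upd (arrays st) 14 0%N 0%N 1)).
  exact: run_set.
move=> st1 r1 m1.
apply: (@run_seq _ _ _ _ _ _ _ _ (fun m' => m' = upd (arrays st1) 14 0%N 1%N (- lam))).
  by apply: run_set => //=; rewrite sub0r m1 /upd /= hlam.
move=> st2 r2 m2; have l2 : loaded (arrays st2).
  by rewrite m2 m1; do 2 apply: loaded_upd => //.
have [hA _ hB _ _] := l2.
have N2 : regs st2 0 = n.+1 by rewrite r2 // r1.
have p2 : arrays st2 14 0%N 0%N = 1 by rewrite m2 m1.
have q2 : arrays st2 14 0%N 1%N = - lam by rewrite m2.
apply: run_weaken (oracleP svdP N2 hA hB p2 q2) => // m' [fr [U [s [V [X [_ Xf _ x y]]]]]].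
split; first exact: loaded_frame fr l2.
  move=> l l4; rewrite fr ?l4 ?orbT // m2 m1 /upd /=.
  by case: l l4 => [|[|?]].
by exists X; split=> //; rewrite scale1r scaleNr in Xf.
Qed.

Lemma run_bisection (delta : R) K st : 0 < delta ->
  regs st 0 = n.+1 -> loaded (arrays st) -> arrays st 14 0%N 9 = delta ->
  0 <= arrays st 14 0%N 7 ->
  bracket A B' b' delta (arrays st 14 0%N 7) (arrays st 14 0%N 8) ->
  (arrays st 14 0%N 8 - arrays st 14 0%N 7) / 2 ^+ K <= eps ->
  run svd bisection 1 (K * (720 * n.+1 ^ 3) + 20) st (fun m' =>
    [/\ loaded m', m' 14 0%N 9 = delta, 0 <= m' 14 0%N 7,
      bracket A B' b' delta (m' 14 0%N 7) (m' 14 0%N 8) &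
      m' 14 0%N 8 - m' 14 0%N 7 <= eps]).
Proof.
move=> d0; elim: K st => [|K IH] st N0 hl h9 l0 br wid.
  have [_ epsE _ _ _] := hl; rewrite expr0 divr1 in wid.
  exists 13, st; split=> //.
  by apply: ExecWhileStop; rewrite /= epsE wid.
have [_ epsE _ _ _] := hl.
have [stop|go] := leP (arrays st 14 0%N 8 - arrays st 14 0%N 7) eps.
  exists 13, st; split=> //.
  - by apply: ExecWhileStop; rewrite /= epsE stop.
  - by rewrite (leq_trans _ (leq_addl _ _)).
have z0 : (0 < n.+1 ^ 3)%N by rewrite expn_gt0.
set l := arrays st 14 0%N 7 in l0 br wid go *.
set u := arrays st 14 0%N 8 in br wid go *.
pose mid := (l + u) / 2.
have lu : l <= mid <= u.
  have lu : l <= u by case: br => mu [_ [/andP[h1 h2] _ _]]; exact: le_trans h2.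
  by rewrite /mid; lra.
pose body := (CSeq (assign 11 (RDiv (RAdd (var 7) (var 8)) (nat_const 2)))
    (CSeq (assign 10 (RDiv (var 11) (var 9)))
    (CSeq penalized_oracle
    (CIf (BRLe (var 6) (var 3)) (assign 7 (var 11)) (assign 8 (var 11)))))).
have : run svd body 1 (20 + (20 + (620 * n.+1 ^ 3 + (10 + 8)))) st (fun m' =>
    [/\ loaded m', m' 14 0%N 9 = delta, 0 <= m' 14 0%N 7,
      bracket A B' b' delta (m' 14 0%N 7) (m' 14 0%N 8) &
      m' 14 0%N 8 - m' 14 0%N 7 = (u - l) / 2]).
  apply: (@run_seq _ _ _ _ _ _ _ _ (fun m' => m' = upd (arrays st) 14 0%N 11 mid)).
    exact: run_set.
  move=> st1 r1 m1.
  apply: (@run_seq _ _ _ _ _ _ _ _ (fun m' => m' = upd (arrays st1) 14 0%N 10 (mid / delta))).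
    by apply: run_set => //=; rewrite m1 /upd /= h9.
  move=> st2 r2 m2; have N2 : regs st2 0 = n.+1 by rewrite r2 // r1.
  have l2 : loaded (arrays st2) by rewrite m2 m1; do 2 apply: loaded_upd => //.
  apply: run_seq; first by apply: (run_penalized_oracle N2 l2 (lam := mid / delta)); rewrite m2.
  move=> st3 r3 [l3 fr [X [Xf _ y3]]].
  have b3 : arrays st3 14 0%N 6 = b' by case: l3.
  have [e7 e8 e9 e11] : [/\ arrays st3 14 0%N 7 = l, arrays st3 14 0%N 8 = u,
      arrays st3 14 0%N 9 = delta & arrays st3 14 0%N 11 = mid].
    by rewrite !fr // m2 m1 /upd /= h9.
  have step := bracket_step d0 lu Xf br.
  apply: run_if; rewrite /= b3 y3; move: step; case: ifP => _ br'; apply: run_set => //=;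
    rewrite /upd /= ?e7 ?e8 ?e9 ?e11; split=> //; try exact: loaded_upd.
  - by case/andP: lu => lm _; exact: le_trans lm.
  - by rewrite /mid; lra.
  - by rewrite /mid; lra.
move=> [t [st1 [h1 h2 h3 [k1 k2 k3 k4 k5]]]].
have N1 : regs st1 0 = n.+1 by rewrite h3.
have [|t' [st2 [g1 g2 g3 g4]]] := IH st1 N1 k1 k2 k3 k4.
  by rewrite k5 -mulrA -invfM -exprS.
exists (12 + t + t').+1, st2; split=> //.
- apply: ExecWhileStep h1 g1 => //=.
  by rewrite epsE -ltNge.
- move: h2 g2 z0; rewrite [(K.+1 * _)%N]mulSn; clear.
  by move: (n.+1 ^ 3)%N => z; move: (K * _)%N => y; lia.
- by move=> r rr; rewrite g3 // h3.
Qed.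

Lemma run_gap_loop st (s : 'rV[R]_n.+1) : regs st 0 = n.+1 ->
  (forall i : 'I_n.+1, arrays st 6 0%N i = s 0 i) ->
  run svd gap_loop 1 (70 * n.+1 ^ 3) st (fun m' =>
    (forall y k l, ~~ [&& y == 14, k == 0%N & (l == 2) || (l == 3)] ->
       m' y k l = arrays st y k l) /\
    m' 14 0%N 2 = arrays st 14 0%N 2 + inv_gap s).
Proof.
move=> N0 sE.
pose F j := (arrays st 6 0%N j)^-1 + (arrays st 6 0%N j - arrays st 6 0%N n)^-1.
have h : run svd gap_loop 1 ((50 + 20) * regs st 0 ^ 1) st (fun m' =>
    [/\ forall y k l, ~~ [&& y == 14, k == 0%N & (l == 2) || (l == 3)] ->
          m' y k l = arrays st y k l,
        m' 14 0%N 2 = arrays st 14 0%N 2 + \sum_(j < regs st 0) F j &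
        m' 14 0%N 3 = arrays st 14 0%N 3 + \sum_(j < regs st 0) 0]).
  apply: (@run_accum _ _ 1 _ _ 0 _ 14 2 3 F (fun=> 0)) => //; first by rewrite N0.
  move=> j st1 jN r1 i1 off1; apply: run_set; first by rewrite expn0.
  rewrite /= (r1 0%N) // N0 subn1 i1 (off1 6) // (off1 6) // !div1r /upd /=; split=> //.
    move=> y k l hn; rewrite -[RHS]off1 //; move: hn; case: (y == 14) => //=.
    by case: (k == 0%N) => //=; rewrite negb_or => /andP[/negPf -> _].
  by rewrite addr0.
apply: run_weaken h => [|m' [h1 h2 _]].
  by rewrite N0 leq_mul2l /= leq_pexp2l.
split=> //; rewrite h2 N0; congr (_ + _); apply: eq_bigr => i _.
by rewrite /F sE (sE ord_max).
Qed.

(** The conclusion is quantified over every maximizer at [lam], because the final query may return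
    any point of that face. *)
Lemma run_choose_multiplier st K C U s V X1 XA : 2 / 2 ^+ K <= eps ->
  regs st 0 = n.+1 -> loaded (arrays st) ->
  C = - B' -> is_svd C U s V -> face C X1 -> face A XA -> b' <= mxip B' XA ->
  (forall i : 'I_n.+1, arrays st 6 0%N i = s 0 i) ->
  arrays st 14 0%N 9 = b' - mxip B' X1 -> mxip B' X1 <= b' ->
  run svd choose_multiplier 1 ((K + 1) * (800 * n.+1 ^ 3)) st (fun m' =>
    loaded m' /\ exists lam, [/\ m' 14 0%N 10 = lam, 0 <= lam &
      forall X, face (A - lam *: B') X -> exists Xo, [/\ SO Xo, mxip B' Xo = b',
        forall Y, SO Y -> mxip B' Y <= b' -> mxip A Y <= mxip A Xo &
        mxip A X - lam * (mxip B' X - b') <= mxip A Xo + eps]]).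
Proof.
move=> hK N0 hl CE C_svd X1f XAf XAb hs h9 X1b.
have z0 : (0 < n.+1 ^ 3)%N by rewrite expn_gt0.
have SO_orth X : SO X -> orth X by case.
have minB Y : SO Y -> mxip B' X1 <= mxip B' Y.
  by case: X1f => _ h /h; rewrite CE !mxipNl lerN2.
have [d0|d0] := leP (b' - mxip B' X1) 0.
  have X1E : mxip B' X1 = b' by apply/eqP; rewrite eq_le X1b -subr_le0.
  apply: (@run_weaken _ _ _ _ (10 + (70 * n.+1 ^ 3 + 20) + 7) _ _ _ _ _ (fun m h => h)).
    by move: (n.+1 ^ 3)%N z0 => z; nia.
  apply: run_if; rewrite /= h9 d0.
  apply: (@run_seq _ _ _ _ _ _ _ _ (fun m' => m' = upd (arrays st) 14 0%N 2 0)).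
    exact: run_set.
  move=> st1 r1 m1; have N1 : regs st1 0 = n.+1 by rewrite r1.
  have l1 : loaded (arrays st1) by rewrite m1; apply: loaded_upd.
  apply: run_seq; first apply: (run_gap_loop N1 (s := s)).
    by move=> i; rewrite m1 /upd /= hs.
  move=> st2 r2 [k2 x2]; have N2 : regs st2 0 = n.+1 by rewrite r2.
  have l2 : loaded (arrays st2).
    case: l1 => [h0 h1 h2 h3 h4]; split; try by rewrite k2.
      by move=> i j; rewrite k2 // h0.
    by move=> i j; rewrite k2 // h2.
  pose lam := n.+1%:R ^+ 2 * inv_gap s / eps.
  apply: run_set => //; have [_ epsE _ _ _] := l2.
  have -> : rval st2 (RDiv (RMul (RMul (RNat (NReg 0)) (RNat (NReg 0))) (var 2)) precision) = lam.
    by rewrite /= N2 x2 epsE m1 /upd /= add0r -expr2.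
  split; first exact: loaded_upd.
  have [_ _ s0 ss _] := C_svd.
  exists lam; split; first by rewrite /upd.
    have [g0 _ _] := inv_gap_ge ord_max s0 ss.
    by rewrite /lam divr_ge0 ?(ltW eps0) // mulr_ge0 // sqr_ge0.
  move=> X [XSO _]; have [|Xo [XoSO Xob Xomax]] := @SO_max R n.+1 A (- B') (- b').
    by exists X1; rewrite mxipNl X1E; case: X1f.
  rewrite mxipNl lerN2 in Xob.
  have XoE : mxip B' Xo = b' by apply/eqP; rewrite eq_le Xob -X1E minB.
  have [|X0 X0f] := face_gap (eps := eps) n2 C_svd A_le1 AA_le1 _ XSO.
    by rewrite eps0 (le_trans eps1) // invf_le1 // ler1n.
  (* For [C = - B'] the deficit of [C] is [mxip B' X - b'], so the last term of [face_gap] is the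
     Lagrangian penalty itself for this [lam]. *)
  rewrite -/lam (face_mxip C_svd X0f) -(face_mxip C_svd X1f) CE !mxipNl X1E => gap.
  exists Xo; split=> //.
    by move=> Y YSO Yb; apply: Xomax => //; rewrite mxipNl lerN2.
  have : mxip A X0 <= mxip A Xo.
    apply: Xomax; first by case: X0f.
    have := face_mxip C_svd X0f; rewrite -(face_mxip C_svd X1f) CE !mxipNl X1E.
    by move=> ->.
  by lra.
have b0 : bracket A B' b' (b' - mxip B' X1) 0 2.
  have [|lam [X [/andP[lam0 lam2] Xf Xb]]] := @multiplier_exists R n
      (@svd_exists n.+1) A B' b' _ X1 XA (fun X h => A_le1 (SO_orth X h))
      (fun X h => signed_le1 (SO_orth X h)) d0 X1f.1 _ XAf XAb.
    by rewrite subKr.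
  exists (lam * (b' - mxip B' X1)), X; split=> //; last first.
    by rewrite mulfK ?gt_eqF.
  by rewrite mulr_ge0 ?(ltW d0) //= -ler_pdivlMr.
apply: (@run_weaken _ _ _ _ (10 + (10 + (K * (720 * n.+1 ^ 3) + 20 + 10)) + 7) _ _ _ _ _ (fun m h => h)).
  by move: (n.+1 ^ 3)%N z0 => z; nia.
apply: run_if; rewrite /= h9 leNgt d0 /=.
apply: (@run_seq _ _ _ _ _ _ _ _ (fun m' => m' = upd (arrays st) 14 0%N 7 0)).
  exact: run_set.
move=> st1 r1 m1.
apply: (@run_seq _ _ _ _ _ _ _ _ (fun m' => m' = upd (arrays st1) 14 0%N 8 2)).
  exact: run_set.
move=> st2 r2 m2; have N2 : regs st2 0 = n.+1 by rewrite r2 // r1.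
have l2 : loaded (arrays st2) by rewrite m2 m1; do 2 apply: loaded_upd => //.
have [e7 e8 e9] : [/\ arrays st2 14 0%N 7 = 0, arrays st2 14 0%N 8 = 2 &
    arrays st2 14 0%N 9 = b' - mxip B' X1] by rewrite m2 m1 /upd /= h9.
apply: run_seq; first apply: (run_bisection (K := K) d0 N2 l2 e9).
- by rewrite e7.
- by rewrite e7 e8.
- by rewrite e7 e8 subr0.
move=> st3 r3 [l3 d3 p3 br3 w3]; apply: run_set => //=.
split; first exact: loaded_upd.
set u := arrays st3 14 0%N 8 in br3 w3 *; rewrite d3.
exists (u / (b' - mxip B' X1)); split; first by rewrite /upd.
  rewrite divr_ge0 ?(ltW d0) //; case: br3 => mu [_ [/andP[h1 h2] _ _]].
  by rewrite (le_trans p3) // (le_trans h1).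
move=> X Xf; apply: bracket_gap d0 br3 w3 _ Xf p3.
by move=> Y YSO; rewrite subKr minB.
Qed.

Lemma run_active_case a b st K Xf XA : 2 / 2 ^+ K <= eps -> a <= b ->
  sg = 1 /\ b' = b \/ sg = -1 /\ b' = - a ->
  regs st 0 = n.+1 -> holds (arrays st) 0 A -> holds (arrays st) 1 B ->
  arrays st 2 0%N 2 = eps -> arrays st 14 0%N 5 = sg -> arrays st 14 0%N 6 = b' ->
  SO Xf -> mxip B' Xf <= b' -> face A XA -> b' <= mxip B' XA ->
  run svd active_case 1 ((K + 1) * (3000 * n.+1 ^ 3)) st (correct_output a b).
Proof.
move=> hK ab sgP N0 hA hB heps hsg hb XfSO Xfb XAf XAb.
have z0 : (0 < n.+1 ^ 3)%N by rewrite expn_gt0.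
have e23 : (n.+1 ^ 2 <= n.+1 ^ 3)%N by rewrite leq_pexp2l.
apply: (@run_weaken _ _ _ _ (60 * n.+1 ^ 3 + (20 + (20 + (600 * n.+1 ^ 3 + (20 +
  ((K + 1) * (800 * n.+1 ^ 3) + (620 * n.+1 ^ 3 + (30 + (30 + (30 + 30)))))))))) _ _ _ _ _
  (fun m h => h)).
  by move: (n.+1 ^ 3)%N z0 => z; nia.
pose E k l := sg * arrays st 1 k l.
apply: run_seq.
  apply: run_weaken (run_fill svd (c := 20) (E := E) _ _ _).
  - by rewrite N0; move: (n.+1 ^ 2)%N (n.+1 ^ 3)%N e23; lia.
  - by move=> m' h; exact: h.
  - by rewrite N0.
  - by [].
  by move=> st' r0 hst' /=; rewrite !hst' // hsg.
move=> st1 r1 k1; have N1 : regs st1 0 = n.+1 by rewrite r1.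
have l1 : loaded (arrays st1).
  split; try by rewrite k1.
    by move=> i j; rewrite k1 hA.
  by move=> i j; rewrite k1 N0 !ltn_ord /E /= hB mxE.
apply: (@run_seq _ _ _ _ _ _ _ _ (fun m' => m' = upd (arrays st1) 14 0%N 0%N 0)).
  exact: run_set.
move=> st2 r2 m2.
apply: (@run_seq _ _ _ _ _ _ _ _ (fun m' => m' = upd (arrays st2) 14 0%N 1%N (-1))).
  by apply: run_set => //=; rewrite sub0r.
move=> st3 r3 m3; have N3 : regs st3 0 = n.+1 by rewrite r3 // r2.
have l3 : loaded (arrays st3) by rewrite m3 m2; do 2 apply: loaded_upd => //.
have [hA3 _ hB3 _ _] := l3.
apply: run_seq; first apply: (oracleP svdP N3 hA3 hB3 (p := 0) (q := -1)).
- by rewrite m3 m2.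
- by rewrite m3.
move=> st4 r4 [fr4 [U [s [V [X1 []]]]]].
rewrite scale0r add0r scaleN1r => C_svd X1f hs _ y4.
have N4 : regs st4 0 = n.+1 by rewrite r4.
have l4 := loaded_frame fr4 l3; have [_ _ _ sg4 b4] := l4.
have X1b : mxip B' X1 <= b'.
  apply: le_trans Xfb; case: X1f => _ /(_ _ XfSO).
  by rewrite !mxipNl lerN2.
apply: (@run_seq _ _ _ _ _ _ _ _
    (fun m' => m' = upd (arrays st4) 14 0%N 9 (b' - mxip B' X1))).
  by apply: run_set => //=; rewrite b4 y4.
move=> st5 r5 m5; have N5 : regs st5 0 = n.+1 by rewrite r5.
have l5 : loaded (arrays st5) by rewrite m5; apply: loaded_upd.
apply: run_seq; first apply: (run_choose_multiplier hK N5 l5 (erefl _) C_svd X1f XAf XAb).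
- by move=> i; rewrite m5 /upd /= hs.
- by rewrite m5 /upd.
- exact: X1b.
move=> st6 r6 [l6 [lam [h10 lam0 lamP]]]; have N6 : regs st6 0 = n.+1 by rewrite r6.
apply: run_seq; first exact: (run_penalized_oracle N6 l6 h10).
move=> st7 r7 [l7 fr7 [X [XF x7 y7]]].
have [Xo [XoSO Xob Xomax gap]] := lamP X XF.
have [_ _ _ sg7 b7] := l7; have lam7 : arrays st7 14 0%N 10 = lam by rewrite fr7.
apply: (@run_seq _ _ _ _ _ _ _ _ (fun m' => m' =
    upd (arrays st7) 3 0%N 0%N (mxip A X - lam * (mxip B' X - b')))).
  by apply: run_set => //=; rewrite x7 y7 lam7 b7.
move=> st8 r8 m8.
apply: (@run_seq _ _ _ _ _ _ _ _ (fun m' => m' = upd (arrays st8) 3 0%N 1%N (sg * b'))).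
  by apply: run_set => //=; rewrite m8 /upd /= sg7 b7.
move=> st9 r9 m9.
apply: (@run_seq _ _ _ _ _ _ _ _ (fun m' => m' = upd (arrays st9) 3 0%N 2 (1 / (1 + lam)))).
  by apply: run_set => //=; rewrite m9 m8 /upd /= lam7.
move=> st10 r10 m10; apply: run_set => //.
have -> : rval st10 (RSub (nat_const 0)
    (RDiv (RMul (var 5) (var 10)) (RAdd (nat_const 1) (var 10)))) = 0 - sg * lam / (1 + lam).
  by rewrite /= m10 m9 m8 /upd /= sg7 lam7.
have [albe [h1 h2 h3 h4]] := dual_output ab lam0 eps0 sgP XF XoSO Xob Xomax gap.
rewrite /correct_output /upd /= m10 m9 m8 /upd /=; split=> //.
by exists Xo; split.
Qed.

End Signed.
Lemma run_program a b st K : 2 / 2 ^+ K <= eps -> a <= b -> feasible B a b !=set0 ->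
  regs st 0 = n.+1 -> holds (arrays st) 0 A -> holds (arrays st) 1 B ->
  arrays st 2 0%N 0%N = a -> arrays st 2 0%N 1%N = b -> arrays st 2 0%N 2 = eps ->
  run svd program 1 ((K + 1) * (4000 * n.+1 ^ 3)) st (correct_output a b).
Proof.
move=> hK ab [Xf [XfSO /andP[aXf Xfb]]] N0 hA hB ha hb he.
have z0 : (0 < n.+1 ^ 3)%N by rewrite expn_gt0.
have e23 : (n.+1 ^ 2 <= n.+1 ^ 3)%N by rewrite leq_pexp2l.
pose T := ((K + 1) * (3000 * n.+1 ^ 3))%N.
apply: (@run_weaken _ _ _ _ (20 + (60 * n.+1 ^ 3 + (20 + (20 + (600 * n.+1 ^ 3 +
  ((20 + (20 + T)) + 10 + 8)))))) _ _ _ _ _ (fun m h => h)).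
  by rewrite /T; move: z0; clear; move: (n.+1 ^ 3)%N => z; nia.
apply: (@run_seq _ _ _ _ _ _ _ _ (fun m' => m' = upd (arrays st) 14 0%N 5 1)).
  exact: run_set.
move=> st1 r1 m1; have N1 : regs st1 0 = n.+1 by rewrite r1.
pose E k l := 1 * arrays st1 1 k l.
apply: run_seq.
  apply: run_weaken (run_fill svd (c := 20) (E := E) _ _ _).
  - by rewrite N1; move: (n.+1 ^ 2)%N (n.+1 ^ 3)%N e23; lia.
  - by move=> m' h; exact: h.
  - by rewrite N1.
  - by [].
  by move=> st' r0 hst' /=; rewrite !hst' // /E; congr (_ * _); rewrite m1.
move=> st2 r2 k2.
apply: (@run_seq _ _ _ _ _ _ _ _ (fun m' => m' = upd (arrays st2) 14 0%N 0%N 1)).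
  exact: run_set.
move=> st3 r3 m3.
apply: (@run_seq _ _ _ _ _ _ _ _ (fun m' => m' = upd (arrays st3) 14 0%N 1%N 0)).
  exact: run_set.
move=> st4 r4 m4; have N4 : regs st4 0 = n.+1 by rewrite r4 // r3 // r2 // r1.
have k4 y k l : y != 12 -> y != 14 -> arrays st4 y k l = arrays st y k l.
  move=> y12 y14; rewrite m4 m3 /upd (negPf y14) /= k2 (negPf y12) /= m1 /upd.
  by rewrite (negPf y14).
have hA4 : holds (arrays st4) 0 A by move=> i j; rewrite k4 // hA.
have hB4 : holds (arrays st4) 12 B.
  by move=> i j; rewrite m4 m3 /upd /= k2 N1 !ltn_ord /= /E mul1r m1 /upd /= hB.
apply: run_seq; first apply: (oracleP svdP N4 hA4 hB4 (p := 1) (q := 0)).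
- by rewrite m4 m3.
- by rewrite m4.
move=> st5 r5 [fr5 [U [s [V [X []]]]]].
rewrite scale1r scale0r addr0 => _ XF _ x5 y5.
have N5 : regs st5 0 = n.+1 by rewrite r5.
have k5 y k l : (y < 4)%N -> arrays st5 y k l = arrays st y k l.
  by move=> y4; rewrite fr5 ?y4 // k4 // neq_ltn (leq_trans y4).
apply: run_if.
have -> : bval st5 (BRLe lower_bound (var 3)) = (a <= mxip B X).
  by rewrite /= (k5 2) // ha y5.
case: ifPn => [aX|]; last rewrite -ltNge => aX.
  apply: (@run_weaken _ _ _ _ ((20 + T) + 8) _ _ _ _ _ (fun m h => h)); first by lia.
  apply: run_if.
  have -> : bval st5 (BRLe (var 3) upper_bound) = (mxip B X <= b).
    by rewrite /= (k5 2) // hb y5.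
  case: ifPn => [Xb|]; last rewrite -ltNge => bX.
    apply: (@run_weaken _ _ _ _ (10 + (10 + (10 + 10))) _ _ _ _ _ (fun m h => h)).
      by rewrite /T; move: (n.+1 ^ 3)%N z0 => z; nia.
    apply: (@run_seq _ _ _ _ _ _ _ _ (fun m' => m' = upd (arrays st5) 3 0%N 0%N (mxip A X))).
      by apply: run_set => //=; rewrite x5.
    move=> st6 r6 m6.
    apply: (@run_seq _ _ _ _ _ _ _ _ (fun m' => m' = upd (arrays st6) 3 0%N 1%N (mxip B X))).
      by apply: run_set => //=; rewrite m6 /upd /= y5.
    move=> st7 r7 m7.
    apply: (@run_seq _ _ _ _ _ _ _ _ (fun m' => m' = upd (arrays st7) 3 0%N 2 1)).
      exact: run_set.
    move=> st8 r8 m8; apply: run_set => //.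
    rewrite /correct_output /upd /= m8 m7 m6 /upd /= normr1 normr0 addr0; split=> //.
    have [XSO Xmax] := XF; exists X; split.
    - by split; [split; rewrite ?aX|move=> Y [YSO _]; exact: Xmax].
    - by rewrite subrr normr0 ltW.
    - by rewrite subrr normr0 ltW.
    move=> Y YSO; rewrite scale1r scale0r addr0.
    by apply: le_trans (Xmax Y YSO) _; rewrite lerDl ltW.
  apply: (@run_seq _ _ _ _ _ _ _ _ (fun m' => m' = upd (arrays st5) 14 0%N 6 b)).
    by apply: run_set => //=; rewrite k5 // hb.
  move=> st6 r6 m6; have N6 : regs st6 0 = n.+1 by rewrite r6.
  have k6 y k l : (y < 4)%N -> arrays st6 y k l = arrays st y k l.
    by move=> y4; rewrite m6 /upd; case: eqP => [yE|_]; [rewrite yE in y4|rewrite k5].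
  apply: (@run_active_case 1 b (or_introl (erefl _)) a b st6 K Xf X) => //.
  - by left.
  - by move=> i j; rewrite k6 // hA.
  - by move=> i j; rewrite k6 // hB.
  - by rewrite k6.
  - by rewrite m6 /upd /= fr5 // m4 m3 /upd /= k2 /= m1.
  - by rewrite m6 /upd.
  - by rewrite scale1r.
  - by rewrite scale1r ltW.
apply: (@run_weaken _ _ _ _ (20 + (20 + T)) _ _ _ _ _ (fun m h => h)); first by lia.
apply: (@run_seq _ _ _ _ _ _ _ _ (fun m' => m' = upd (arrays st5) 14 0%N 5 (-1))).
  by apply: run_set => //=; rewrite sub0r.
move=> st6 r6 m6.
apply: (@run_seq _ _ _ _ _ _ _ _ (fun m' => m' = upd (arrays st6) 14 0%N 6 (- a))).
  by apply: run_set => //=; rewrite sub0r m6 /upd /= k5 // ha.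
move=> st7 r7 m7; have N7 : regs st7 0 = n.+1 by rewrite r7 // r6.
have k7 y k l : (y < 4)%N -> arrays st7 y k l = arrays st y k l.
  by move=> y4; rewrite m7 m6 /upd; case: eqP => [yE|_]; [rewrite yE in y4|rewrite k5].
apply: (@run_active_case (-1) (- a) (or_intror (erefl _)) a b st7 K Xf X) => //.
- by right.
- by move=> i j; rewrite k7 // hA.
- by move=> i j; rewrite k7 // hB.
- by rewrite k7.
- by rewrite m7 m6 /upd.
- by rewrite m7 /upd.
- by rewrite scaleN1r mxipNl lerN2.
- by rewrite scaleN1r mxipNl lerN2 ltW.
Qed.

End Correctness.

Theorem theorem4 (R : realType) :
  exists (P : cmd) (C : R), forall svd : svd_routine R, svd_correct svd ->
  forall (n : nat) (A B : 'M[R]_n) (a b eps : R),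
  (3 <= n)%N -> trace_norm A = 1 -> trace_norm B = 1 ->
  a <= b -> feasible B a b !=set0 -> 0 < eps -> eps <= 2^-1 ->
  exists (t : nat) (st : state R),
  [/\ exec svd P (input A B a b eps) t st,
      t%:R <= C * (n%:R ^+ 3 * ln (1 / eps) ^+ 2)
    & let alpha := output st 2 in
      let beta := output st 3 in
      `|alpha| + `|beta| = 1 /\
      exists Xopt : 'M[R]_n,
      [/\ optimal A B a b Xopt,
          `|output st 0 - mxip A Xopt| <= eps,
          `|output st 1 - mxip B Xopt| <= eps
        & forall X, SO X ->
            mxip (alpha *: A + beta *: B) X
              <= mxip (alpha *: A + beta *: B) Xopt + eps]].
Proof.
have [c hc] := halving_steps R.
(* The run costs [(K + 1) * 4000 * n ^ 3] with [K <= c * L] for [L = ln (1 / eps)]. As [L >= ln 2],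
   both [c * L] and [1] are bounded by multiples of [L ^ 2], with the factors [c / ln 2] and
   [1 / ln 2 ^ 2]. *)
exists program, (4000 * (c / ln 2 + 1 / ln 2 ^+ 2)).
move=> svd svdP [|n] A B a b eps // n3 trA trB ab feas eps0 eps1.
have [K hK Kc] := hc eps eps0 eps1.
have putE x st (M : 'M[R]_n.+1) : holds (arrays (put_mx st x M)) x M.
  by move=> i j; rewrite /= eqxx !valK.
have [||t [st [run tle _ out]]] := run_program (st := input A B a b eps)
    svdP n3 trA trB eps0 eps1 hK ab feas (erefl _) _ _ (erefl _) (erefl _) (erefl _).
- by move=> i j; rewrite /input /= valK valK.
- by move=> i j; rewrite /input /= valK valK.
exists t, st; split=> //.
have l2 : 0 < ln 2 :> R by rewrite ln_gt0 // ltr1n.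
have L2 : ln 2 <= ln (1 / eps).
  by rewrite ler_ln ?posrE ?divr_gt0 // ler_pdivlMr //; lra.
set L := ln (1 / eps) in Kc L2 *.
have r1 : 1 <= L / ln 2 by rewrite ler_pdivlMr // mul1r.
have c0 : 0 <= c * L by apply: le_trans Kc.
have h1 : c * L <= c / ln 2 * L ^+ 2.
  have -> : c / ln 2 * L ^+ 2 = c * L * (L / ln 2) by rewrite expr2; ring.
  by rewrite ler_peMr.
have h2 : 1 <= 1 / ln 2 ^+ 2 * L ^+ 2.
  have -> : 1 / ln 2 ^+ 2 * L ^+ 2 = (L / ln 2) ^+ 2 by rewrite expr_div_n mul1r mulrC.
  exact: exprn_ege1.
have : t%:R <= (K + 1)%:R * (4000 * n.+1%:R ^+ 3) :> R.
  by rewrite -natrX -!natrM ler_nat.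
move=> /le_trans; apply.
have n0 : 0 <= n.+1%:R ^+ 3 :> R by rewrite exprn_ge0.
rewrite natrD; move: (n.+1%:R ^+ 3) n0 (4000 : R) (ler0n R 4000) => N n0 k k0.
have -> : k * (c / ln 2 + 1 / ln 2 ^+ 2) * (N * L ^+ 2) =
   (c / ln 2 * L ^+ 2 + 1 / ln 2 ^+ 2 * L ^+ 2) * (k * N) by ring.
by apply: ler_wpM2r; [exact: mulr_ge0|lra].
Qed.
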